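(* Let $k$ be an algebraically closed field, $A=kQ$ the path algebra of a finite quiver $Q$, $T$ a finite-dimensional left $A$-module, and $A[T]$ the one-point extension of $A$ by $T$. Let $\tilde M=(M,V,f:T\otimes_kV\to M)$ be an $A[T]$-module. Then \[ 0\to P_2(\tilde M)\xrightarrow{h}P_1(\tilde M)\xrightarrow{g}P_0(\tilde M)\to\tilde M\to 0 \] is a projective resolution of $\tilde M$ as an $A[T]$-module, where \[ P_2(\tilde M)=\big((A\otimes_RX\otimes_RA)\otimes_A(T\otimes_kV),\,0,\,0\big), \] \[ P_1(\tilde M)=\big((A\otimes_R(T\otimes_kV))\oplus((A\otimes_RX\otimes_RA)\otimes_AM),\,0,\,0\big), \] \[ P_0(\tilde M)=\big((T\otimes_kV)\oplus(A\otimes_RM),\;V,\;(\mathrm{id}\;\;0)^\top\big), \] the map $P_0(\tilde M)\to\tilde M$ is given by $(f\;\;\mu_M)$ on the $A$-module component (with $\mu_M:A\otimes_RM\to M$ the action map) and by $\mathrm{id}_V$ on the vector space component, and $g,h$ are given on the $A$-module components by \[ g\big(a\otimes(t\otimes v)+a'\otimes x\otimes m\big)=at\otimes v-a\otimes f(t\otimes v)+a'x\otimes m-a'\otimes xm, \] \[ h\big(a\otimes x\otimes(t\otimes v)\big)=\big(ax\otimes(t\otimes v)-a\otimes(xt\otimes v)\big)+a\otimes x\otimes f(t\otimes v), \] for $a,a'\in A$, $x\in X$, $t\in T$, $v\in V$, $m\in M$. In particular, $\mathrm{gldim}\,A[T]\le 2$.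
   Context: $A[T]$ is the $k$-algebra of formal matrices $\begin{pmatrix} a & t\\ 0&\lambda\end{pmatrix}$ with $a\in A$, $t\in T$, $\lambda\in k$, with componentwise addition and formal matrix multiplication. Left $A[T]$-modules are identified with triples $(M,V,f)$ where $M$ is a left $A$-module, $V$ a $k$-vector space and $f:T\otimes_kV\to M$ an $A$-module map; a morphism $(M,V,f)\to(N,W,g)$ is a pair $(\varphi_1:M\to N\text{ $A$-linear},\ \varphi_2:V\to W\text{ $k$-linear})$ with $\varphi_1f=g(\mathrm{id}_T\otimes\varphi_2)$. $R\subseteq A$ is the semisimple subalgebra spanned by the trivial paths (vertices), and $X$ is the $R$-$R$-bimodule spanned over $k$ by the arrows of $Q$, so that $A$ is identified with the tensor algebra $\mathsf T_RX$. For an $A$-module $L$, $(A\otimes_RX\otimes_RA)\otimes_AL$ is identified with $A\otimes_RX\otimes_RL$. *)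

(* Defs.v *)
From HB Require Import structures.
From mathcomp Require Import all_boot.
From mathcomp Require Import ssralg ssrint matrix ring_quotient.
From mathcomp Require Import finmap boolp.
From mathcomp Require Import monalg.

Set Implicit Arguments.
Unset Strict Implicit.
Unset Printing Implicit Defensive.

Import GRing.Theory.

Local Open Scope ring_scope.
Local Open Scope quotient_scope.

(* Additive extension to a free module of a map given on multiples of the
   basis elements. *)
Section MalgExtension.
Variables (K : choiceType) (G H : zmodType) (F : K -> G -> H).

Definition mext (z : {malg G[K]}) : H := \sum_(k <- msupp z) F k z@_k.

Hypothesis F_additive : forall k, {morph F k : x y / x - y}.

Lemma mext_F0 k : F k 0 = 0.
Proof. by rewrite -[X in F k X](subrr 0) F_additive subrr. Qed.

Lemma mextw (d : {fset K}) z : (msupp z `<=` d)%fset ->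
  mext z = \sum_(k <- d) F k z@_k.
Proof.
move=> le_zd; apply: big_fset_incl => // k _ /mcoeff_outdom ->.
exact: mext_F0.
Qed.

Lemma mextB : {morph mext : x y / x - y}.
Proof.
move=> x y; pose d := (msupp x `|` msupp y)%fset.
rewrite (@mextw d x) ?fsubsetUl // (@mextw d y) ?fsubsetUr //.
rewrite (@mextw d (x - y)) ?msuppB_le // -sumrB.
by apply: eq_bigr => k _; rewrite mcoeffB F_additive.
Qed.

Lemma mextU k x : mext << x *g k >> = F k x.
Proof. by rewrite (mextw msuppU_le) big_seq_fset1 mcoeffUU. Qed.

Lemma mext0 : mext 0 = 0.
Proof. by rewrite -[X in mext X](subrr 0) mextB subrr. Qed.

Lemma mextD : {morph mext : x y / x + y}.
Proof.
move=> x y; have -> : x + y = x - (0 - y) by rewrite sub0r opprK.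
by rewrite !mextB mext0 sub0r opprK.
Qed.
End MalgExtension.

Lemma malg_ind (K : choiceType) (G : zmodType) (P : {malg G[K]} -> Prop) :
    P 0 -> (forall x y, P x -> P y -> P (x + y)) ->
    (forall k c, P << c *g k >>) ->
  forall z, P z.
Proof. by move=> P0 PD PU z; rewrite (monalgE z); elim/big_ind: _. Qed.

HB.mixin Record Lmodule_isBimodule (S R : pzRingType) M of GRing.Lmodule S M := {
  ract : M -> R -> M;
  ractDl : forall x y r, ract (x + y) r = ract x r + ract y r;
  ractDr : forall x r s, ract x (r + s) = ract x r + ract x s;
  ractA : forall x r s, ract x (r * s) = ract (ract x r) s;
  ract1 : forall x, ract x 1 = x;
  ractZ : forall s x r, ract (s *: x) r = s *: ract x r
}.

#[short(type="bimodType")]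
HB.structure Definition Bimodule (S R : pzRingType) :=
  {M of GRing.Lmodule S M & Lmodule_isBimodule S R M}.

Section TensorDef.
Variables (S R : pzRingType) (U : bimodType S R) (V : lmodType R).

Inductive tensor_rel : {malg int[(U * V)%type]} -> Prop :=
| tensor_rel0 : tensor_rel 0
| tensor_relB x y : tensor_rel x -> tensor_rel y -> tensor_rel (x - y)
| tensor_relDl (u u' : U) (v : V) :
    tensor_rel (<< (u + u', v) >> - << (u, v) >> - << (u', v) >>)
| tensor_relDr (u : U) (v v' : V) :
    tensor_rel (<< (u, v + v') >> - << (u, v) >> - << (u, v') >>)
| tensor_relM (u : U) (r : R) (v : V) :
    tensor_rel (<< (ract u r, v) >> - << (u, r *: v) >>).

Definition tensor_null : {pred {malg int[(U * V)%type]}} :=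
  fun z => `[< tensor_rel z >].

Fact tensor_null_zmod : zmod_closed tensor_null.
Proof.
split; first by apply/asboolP; exact: tensor_rel0.
by move=> x y /asboolP hx /asboolP hy; apply/asboolP; exact: tensor_relB.
Qed.

HB.instance Definition _ :=
  GRing.isZmodClosed.Build _ tensor_null tensor_null_zmod.

Definition tensor : Type := Quotient.quot tensor_null.

HB.instance Definition _ := GRing.Zmodule.on tensor.
End TensorDef.

HB.lock Definition tens (S R : pzRingType) (U : bimodType S R)
    (V : lmodType R) (u : U) (v : V) : tensor U V :=
  \pi_(Quotient.quot (@tensor_null S R U V)) << (u, v) >>.

(* The additive map given by a balanced map [b] (see [tensor_liftE]). *)
HB.lock Definition tensor_lift (S R : pzRingType) (U : bimodType S R)
    (V : lmodType R) (G : zmodType) (b : U -> V -> G) (z : tensor U V) : G :=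
  mext (fun p (n : int) => b p.1 p.2 *~ n)
    (repr (z : Quotient.quot (@tensor_null S R U V))).

Section TensorTheory.
Variables (S R : pzRingType) (U : bimodType S R) (V : lmodType R).
Local Notation tensor := (tensor U V).
Local Notation tensor_null := (@tensor_null S R U V).
Local Notation tensor_rel := (@tensor_rel S R U V).
Local Notation tens := (@tens S R U V).

Lemma tensor_piB (x y : {malg int[(U * V)%type]}) :
  \pi_(Quotient.quot tensor_null) (x - y) =
  \pi_(Quotient.quot tensor_null) x - \pi_(Quotient.quot tensor_null) y
    :> tensor.
Proof. by rewrite Quotient.pi_add Quotient.pi_opp. Qed.

Lemma tensor_pi0 z : tensor_rel z ->
  \pi_(Quotient.quot tensor_null) z = 0 :> tensor.
Proof.
move=> hz; transitivity (\pi_(Quotient.quot tensor_null) (0 : {malg int[(U * V)%type]})).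
  by apply/eqP; rewrite -Quotient.idealrBE subr0; apply/asboolP.
by rewrite -[X in \pi_(_) X](subrr 0) tensor_piB subrr.
Qed.

Lemma tensE u v : tens u v = \pi_(Quotient.quot tensor_null) << (u, v) >>.
Proof. by rewrite unlock. Qed.

Lemma tensDl u u' v : tens (u + u') v = tens u v + tens u' v.
Proof.
apply/eqP; rewrite -subr_eq0 opprD addrA !tensE -!tensor_piB; apply/eqP.
exact/tensor_pi0/tensor_relDl.
Qed.

Lemma tensDr u v v' : tens u (v + v') = tens u v + tens u v'.
Proof.
apply/eqP; rewrite -subr_eq0 opprD addrA !tensE -!tensor_piB; apply/eqP.
exact/tensor_pi0/tensor_relDr.
Qed.

Lemma tensM u r v : tens (ract u r) v = tens u (r *: v).
Proof.
apply/eqP; rewrite -subr_eq0 !tensE -!tensor_piB; apply/eqP.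
exact/tensor_pi0/tensor_relM.
Qed.

Lemma tensor_ind (P : tensor -> Prop) :
    (forall x y, P x -> P y -> P (x - y)) -> (forall u v, P (tens u v)) ->
  forall z, P z.
Proof.
move=> PB Pt0 z.
have Pt u v : P (\pi_(Quotient.quot tensor_null) << (u, v) >>).
  by rewrite -tensE.
rewrite -[z]reprK; move: (repr z) => {z}.
have P0 : P 0 by rewrite -(subrr (tens 0 0)); apply: PB.
have PN x : P x -> P (- x) by move=> Px; rewrite -[- x]add0r; exact: PB.
have PD x y : P x -> P y -> P (x + y).
  by move=> Px Py; rewrite -[y]opprK; apply: PB => //; apply: PN.
apply: malg_ind => [|x y Px Py|[u v] n].
- by rewrite tensor_pi0 //; exact: tensor_rel0.
- by rewrite Quotient.pi_add; apply: PD.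
have PU (m : nat) : P (\pi_(Quotient.quot tensor_null)
    (<< (m%:Z : int) *g (u, v) >> : {malg int[(U * V)%type]})).
  elim: m => [|m IH]; first by rewrite monalgU0 tensor_pi0 //; exact: tensor_rel0.
  by rewrite -addn1 PoszD monalgUD Quotient.pi_add; apply: PD => //; exact: Pt.
case: n => n //; rewrite NegzE monalgUN Quotient.pi_opp; exact/PN/PU.
Qed.

Section Lift.
Variables (G : zmodType) (b : U -> V -> G).

Definition balanced : Prop :=
  [/\ forall u u' v, b (u + u') v = b u v + b u' v,
      forall u v v', b u (v + v') = b u v + b u v'
    & forall u r v, b (ract u r) v = b u (r *: v)].

Local Notation tensor_lift := (@tensor_lift S R U V G b).

Hypothesis b_bal : balanced.

Let F (p : (U * V)%type) (n : int) : G := b p.1 p.2 *~ n.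

Let F_additive p : {morph F p : x y / x - y}.
Proof. by move=> x y; rewrite /F mulrzBr. Qed.

Let mext_rel z : tensor_rel z -> mext F z = 0.
Proof.
have [bDl bDr bM] := b_bal.
have bB := mextB F_additive; have bU := mextU F_additive.
elim=> [|x y _ hx _ hy|u u' v|u v v'|u r v].
- exact: mext0.
- by rewrite bB hx hy subrr.
- by rewrite !bB !bU /F /= !mulr1z bDl -addrA -opprD subrr.
- by rewrite !bB !bU /F /= !mulr1z bDr -addrA -opprD subrr.
- by rewrite !bB !bU /F /= !mulr1z bM subrr.
Qed.

Let lift_pi z : tensor_lift (\pi_(Quotient.quot tensor_null) z) = mext F z.
Proof.
apply/eqP; rewrite -subr_eq0 unlock -mextB //; apply/eqP/mext_rel.
apply/asboolP.
have : repr (\pi_(Quotient.quot tensor_null) z) == z %[mod Quotient.quot tensor_null].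
  by rewrite reprK.
by rewrite -Quotient.idealrBE.
Qed.

Lemma tensor_liftE u v : tensor_lift (tens u v) = b u v.
Proof. by rewrite tensE lift_pi mextU. Qed.

Lemma tensor_liftB : {morph tensor_lift : x y / x - y}.
Proof.
move=> x y; rewrite -[x]reprK -[y]reprK -tensor_piB.
by rewrite !lift_pi mextB.
Qed.

Lemma tensor_liftD : {morph tensor_lift : x y / x + y}.
Proof.
move=> x y; have lift0 : tensor_lift 0 = 0 by rewrite -[X in tensor_lift X](subrr 0) tensor_liftB subrr.
have -> : x + y = x - (0 - y) by rewrite sub0r opprK.
by rewrite !tensor_liftB lift0 sub0r opprK.
Qed.
End Lift.
End TensorTheory.

Arguments tens {S R U V} u v.

Notation "u *t v" := (tens u v) (at level 40, left associativity) : ring_scope.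

Lemma tensor_addf_eq (S R : pzRingType) (U : bimodType S R) (V : lmodType R)
    (G : zmodType) (f g : tensor U V -> G) :
    {morph f : x y / x - y} -> {morph g : x y / x - y} ->
    (forall u v, f (u *t v) = g (u *t v)) -> f =1 g.
Proof.
move=> fB gB fg; apply: tensor_ind => // x y fgx fgy.
by rewrite fB gB fgx fgy.
Qed.

Section TensorLeft.
Variables (S R : pzRingType) (U : bimodType S R) (V : lmodType R).

Definition tensor_scale (s : S) : tensor U V -> tensor U V :=
  tensor_lift (fun u v => (s *: u) *t v).

Fact tensor_scale_bal s : balanced (fun (u : U) (v : V) => (s *: u) *t v).
Proof.
split=> [u u' v|u v v'|u r v]; first by rewrite scalerDr tensDl.
  by rewrite tensDr.
by rewrite -ractZ tensM.
Qed.

Let scaleB s := tensor_liftB (tensor_scale_bal s).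
Let scaleE s := tensor_liftE (tensor_scale_bal s).

Fact tensor_scaleA a b z :
  tensor_scale a (tensor_scale b z) = tensor_scale (a * b) z.
Proof.
move: z; apply: tensor_addf_eq => [x y|x y|u v]; rewrite /tensor_scale.
- by rewrite !scaleB.
- by rewrite scaleB.
by rewrite !scaleE scalerA.
Qed.

Fact tensor_scale1 : left_id 1 tensor_scale.
Proof.
apply: tensor_addf_eq => [x y|x y|u v] //; rewrite /tensor_scale.
  by rewrite scaleB.
by rewrite scaleE scale1r.
Qed.

Fact tensor_scaleDr : right_distributive tensor_scale +%R.
Proof. by move=> a x y; rewrite /tensor_scale tensor_liftD //; exact: tensor_scale_bal. Qed.

Fact tensor_scaleDl z : {morph tensor_scale^~ z : a b / a + b}.
Proof.
move=> a b /=; move: z; apply: tensor_addf_eq => [x y|x y|u v]; rewrite /tensor_scale.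
- by rewrite scaleB.
- by rewrite !scaleB opprD addrACA.
by rewrite !scaleE scalerDl tensDl.
Qed.

HB.instance Definition _ := GRing.Zmodule_isLmodule.Build S (tensor U V)
  tensor_scaleA tensor_scale1 tensor_scaleDr tensor_scaleDl.

Lemma tensZ s (u : U) (v : V) : s *: (u *t v) = (s *: u) *t v.
Proof. exact: scaleE. Qed.
End TensorLeft.

Section TensorRight.
Variables (S R P : pzRingType) (U : bimodType S R) (W : bimodType R P).

Definition tensor_ract (z : tensor U W) (p : P) : tensor U W :=
  tensor_lift (fun u w => u *t ract w p) z.

Fact tensor_ract_bal p : balanced (fun (u : U) (w : W) => u *t ract w p).
Proof.
split=> [u u' v|u v v'|u r v]; first by rewrite tensDl.
  by rewrite ractDl tensDr.
by rewrite ractZ tensM.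
Qed.

Let ractB p := tensor_liftB (tensor_ract_bal p).
Let ractE p := tensor_liftE (tensor_ract_bal p).

Fact tensor_ractDl x y p :
  tensor_ract (x + y) p = tensor_ract x p + tensor_ract y p.
Proof. by rewrite /tensor_ract tensor_liftD //; exact: tensor_ract_bal. Qed.

Fact tensor_ractDr x p q :
  tensor_ract x (p + q) = tensor_ract x p + tensor_ract x q.
Proof.
move: x; apply: tensor_addf_eq => [x y|x y|u v]; rewrite /tensor_ract.
- by rewrite ractB.
- by rewrite !ractB opprD addrACA.
by rewrite !ractE ractDr tensDr.
Qed.

Fact tensor_ractA x p q :
  tensor_ract x (p * q) = tensor_ract (tensor_ract x p) q.
Proof.
move: x; apply: tensor_addf_eq => [x y|x y|u v]; rewrite /tensor_ract.
- by rewrite ractB.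
- by rewrite !ractB.
by rewrite !ractE ractA.
Qed.

Fact tensor_ract1 x : tensor_ract x 1 = x.
Proof.
move: x; apply: tensor_addf_eq => [x y|x y|u v] //; rewrite /tensor_ract.
  by rewrite ractB.
by rewrite ractE ract1.
Qed.

Fact tensor_ractZ s x p : tensor_ract (s *: x) p = s *: tensor_ract x p.
Proof.
move: x; apply: tensor_addf_eq => [x y|x y|u v]; rewrite /tensor_ract.
- by rewrite scalerBr ractB.
- by rewrite ractB scalerBr.
by rewrite tensZ !ractE tensZ.
Qed.

HB.instance Definition _ := Lmodule_isBimodule.Build S P (tensor U W)
  tensor_ractDl tensor_ractDr tensor_ractA tensor_ract1 tensor_ractZ.

Lemma tens_ract (u : U) (w : W) (p : P) : ract (u *t w) p = u *t ract w p.
Proof. exact: ractE. Qed.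
End TensorRight.
(* Restriction of scalars of a left module along [phi]. *)
Definition restr (S R : pzRingType) (phi : {rmorphism S -> R})
  (M : lmodType R) : Type := M.

Section Restr.
Variables (S R : pzRingType) (phi : {rmorphism S -> R}) (M : lmodType R).

HB.instance Definition _ := GRing.Zmodule.on (restr phi M).

Definition restr_scale (s : S) (m : restr phi M) : restr phi M :=
  phi s *: (m : M).

Fact restr_scaleA a b m :
  restr_scale a (restr_scale b m) = restr_scale (a * b) m.
Proof. by rewrite /restr_scale scalerA rmorphM. Qed.

Fact restr_scale1 : left_id 1 restr_scale.
Proof. by move=> m; rewrite /restr_scale rmorph1 scale1r. Qed.

Fact restr_scaleDr : right_distributive restr_scale +%R.
Proof. by move=> a x y; rewrite /restr_scale scalerDr. Qed.

Fact restr_scaleDl m : {morph restr_scale^~ m : a b / a + b}.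
Proof. by move=> a b; rewrite /restr_scale rmorphD scalerDl. Qed.

HB.instance Definition _ := GRing.Zmodule_isLmodule.Build S (restr phi M)
  restr_scaleA restr_scale1 restr_scaleDr restr_scaleDl.
End Restr.

(* The ring [B], as an [(S, R)]-bimodule via [phi] on the left and [psi] on
   the right. *)
Definition bireg (S R B : pzRingType) (phi : {rmorphism S -> B})
  (psi : {rmorphism R -> B}) : Type := B.

Section Bireg.
Variables (S R B : pzRingType).
Variables (phi : {rmorphism S -> B}) (psi : {rmorphism R -> B}).

HB.instance Definition _ := GRing.Zmodule.on (bireg phi psi).

Definition bireg_scale (s : S) (b : bireg phi psi) : bireg phi psi :=
  phi s * (b : B).
Definition bireg_ract (b : bireg phi psi) (r : R) : bireg phi psi :=
  (b : B) * psi r.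

Fact bireg_scaleA a b m :
  bireg_scale a (bireg_scale b m) = bireg_scale (a * b) m.
Proof. by rewrite /bireg_scale rmorphM mulrA. Qed.

Fact bireg_scale1 : left_id 1 bireg_scale.
Proof. by move=> m; rewrite /bireg_scale rmorph1 mul1r. Qed.

Fact bireg_scaleDr : right_distributive bireg_scale +%R.
Proof. by move=> a x y; rewrite /bireg_scale mulrDr. Qed.

Fact bireg_scaleDl m : {morph bireg_scale^~ m : a b / a + b}.
Proof. by move=> a b; rewrite /bireg_scale rmorphD mulrDl. Qed.

HB.instance Definition _ := GRing.Zmodule_isLmodule.Build S (bireg phi psi)
  bireg_scaleA bireg_scale1 bireg_scaleDr bireg_scaleDl.

Fact bireg_ractDl x y r : bireg_ract (x + y) r = bireg_ract x r + bireg_ract y r.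
Proof. by rewrite /bireg_ract mulrDl. Qed.

Fact bireg_ractDr x r s : bireg_ract x (r + s) = bireg_ract x r + bireg_ract x s.
Proof. by rewrite /bireg_ract rmorphD mulrDr. Qed.

Fact bireg_ractA x r s : bireg_ract x (r * s) = bireg_ract (bireg_ract x r) s.
Proof. by rewrite /bireg_ract rmorphM mulrA. Qed.

Fact bireg_ract1 x : bireg_ract x 1 = x.
Proof. by rewrite /bireg_ract rmorph1 mulr1. Qed.

Fact bireg_ractZ s x r : bireg_ract (s *: x) r = s *: bireg_ract x r.
Proof. by rewrite /bireg_ract /GRing.scale /= /bireg_scale mulrA. Qed.

HB.instance Definition _ := Lmodule_isBimodule.Build S R (bireg phi psi)
  bireg_ractDl bireg_ractDr bireg_ractA bireg_ract1 bireg_ractZ.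
End Bireg.

Definition projective (S : pzRingType) (P : lmodType S) : Prop :=
  forall (M N : lmodType S) (p : {linear M -> N}) (f : {linear P -> N}),
    (forall y, exists x, p x = y) ->
  exists g : {linear P -> M}, forall x, p (g x) = f x.

Definition exact_at (S : pzRingType) (L M N : lmodType S)
    (u : {linear L -> M}) (v : {linear M -> N}) : Prop :=
  forall x, v x = 0 <-> exists y, u y = x.

Definition proj_resolution (S : pzRingType) (M : lmodType S)
    (P : nat -> lmodType S) (d : forall i, {linear P i.+1 -> P i})
    (e : {linear P 0%N -> M}) : Prop :=
  [/\ forall i, projective (P i),
      forall x, exists y, e y = x,
      exact_at (d 0%N) e
    & forall i, exact_at (d i.+1) (d i)].

Definition proj_dim_le (S : pzRingType) (n : nat) (M : lmodType S) : Prop :=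
  exists (P : nat -> lmodType S) (d : forall i, {linear P i.+1 -> P i})
    (e : {linear P 0%N -> M}),
    proj_resolution d e /\ forall i, (n < i)%N -> forall x : P i, x = 0.

(* Left global dimension. *)
Definition gldim_le (S : pzRingType) (n : nat) : Prop :=
  forall M : lmodType S, proj_dim_le n M.

(* One-point extensions.  [(a, t, l)] stands for the matrix with rows
   [a t] and [0 l]. *)
Definition one_point (A K : pzRingType) (T : bimodType A K) : Type :=
  (A * T * K)%type.

Section OnePoint.
Variables (A K : pzRingType) (T : bimodType A K).

HB.instance Definition _ := GRing.Zmodule.on (one_point T).

Definition one_point_one : one_point T := (1, 0, 1).
Definition one_point_mul (x y : one_point T) : one_point T :=
  (x.1.1 * y.1.1, x.1.1 *: y.1.2 + ract x.1.2 y.2, x.2 * y.2).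

Lemma ract0 (t : T) : ract t 0 = 0.
Proof. by apply: (addIr (ract t 0)); rewrite -ractDr !add0r. Qed.

Lemma ract0l (r : K) : ract (0 : T) r = 0.
Proof. by apply: (addIr (ract 0 r)); rewrite -ractDl !add0r. Qed.

Fact one_point_mulA : associative one_point_mul.
Proof.
move=> [[a t] l] [[a' t'] l'] [[a'' t''] l'']; rewrite /one_point_mul /=.
by rewrite !mulrA scalerDr scalerA ractDl ractZ ractA addrA.
Qed.

Fact one_point_mul1 : left_id one_point_one one_point_mul.
Proof.
move=> [[a t] l]; rewrite /one_point_mul /=.
by rewrite !mul1r scale1r ract0l addr0.
Qed.

Fact one_point_1mul : right_id one_point_one one_point_mul.
Proof.
move=> [[a t] l]; rewrite /one_point_mul /=.
by rewrite !mulr1 scaler0 ract1 add0r.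
Qed.

Fact one_point_mulDl : left_distributive one_point_mul +%R.
Proof.
move=> [[a t] l] [[a' t'] l'] [[a'' t''] l''].
by congr (_, _, _); rewrite /= ?mulrDl // scalerDl ractDl addrACA.
Qed.

Fact one_point_mulDr : right_distributive one_point_mul +%R.
Proof.
move=> [[a t] l] [[a' t'] l'] [[a'' t''] l''].
by congr (_, _, _); rewrite /= ?mulrDr // scalerDr ractDr addrACA.
Qed.

HB.instance Definition _ := GRing.Zmodule_isPzRing.Build (one_point T)
  one_point_mulA one_point_mul1 one_point_1mul one_point_mulDl one_point_mulDr.

Record triple := Triple {
  tmod : lmodType A;
  tvec : lmodType K;
  tmap : {linear tensor T tvec -> tmod}
}.

(* The left module over the one-point extension given by a triple: column
   vectors, on which matrices act by formal multiplication. *)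
Definition triple_module (X : triple) : Type := (tmod X * tvec X)%type.

Section TripleModule.
Variable X : triple.

HB.instance Definition _ := GRing.Zmodule.on (triple_module X).

Definition triple_scale (x : one_point T) (y : triple_module X) :
    triple_module X :=
  (x.1.1 *: y.1 + tmap X (x.1.2 *t y.2), x.2 *: y.2).

Lemma tens0l (v : tvec X) : (0 : T) *t v = 0.
Proof. by apply: (addIr ((0 : T) *t v)); rewrite -tensDl !add0r. Qed.

Fact triple_scaleA x y z :
  triple_scale x (triple_scale y z) = triple_scale (x * y) z.
Proof.
case: x y z => [[a t] l] [[a' t'] l'] [m v]; rewrite /triple_scale /=.
rewrite !scalerA scalerDr scalerA -linearZ /= tensZ -addrA -linearD /=.
by rewrite -tensM -tensDl.
Qed.

Fact triple_scale1 : left_id 1 triple_scale.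
Proof.
move=> [m v]; rewrite /triple_scale /= !scale1r tens0l linear0 addr0.
by [].
Qed.

Fact triple_scaleDr : right_distributive triple_scale +%R.
Proof.
move=> [[a t] l] [m v] [m' v']; rewrite /triple_scale /=.
by congr (_, _); rewrite /= scalerDr // tensDr linearD addrACA.
Qed.

Fact triple_scaleDl z : {morph triple_scale^~ z : x y / x + y}.
Proof.
case: z => [m v] [[a t] l] [[a' t'] l']; rewrite /triple_scale /=.
by congr (_, _); rewrite /= scalerDl // tensDl linearD addrACA.
Qed.

HB.instance Definition _ :=
  GRing.Zmodule_isLmodule.Build (one_point T) (triple_module X)
    triple_scaleA triple_scale1 triple_scaleDr triple_scaleDl.
End TripleModule.
End OnePoint.

Record quiver := Quiver {
  vertex : finType;
  arrow : finType;
  source : arrow -> vertex;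
  target : arrow -> vertex
}.

Section Paths.
Variable Q : quiver.

(* Paths compose like functions: the arrows of a path are listed from the last
   one traversed to the first, and [(i, s)] is a path with target [i]. *)
Fixpoint walk (i : vertex Q) (s : seq (arrow Q)) : bool :=
  if s is x :: s' then (target x == i) && walk (source x) s' else true.

Record qpath := QPath {
  qpath_val : vertex Q * seq (arrow Q);
  qpath_walk : walk qpath_val.1 qpath_val.2
}.

HB.instance Definition _ := [isSub for qpath_val].
HB.instance Definition _ := [Choice of qpath by <:].

Definition ptarget (p : qpath) : vertex Q := (qpath_val p).1.
Definition parrows (p : qpath) : seq (arrow Q) := (qpath_val p).2.
Definition psource (p : qpath) : vertex Q :=
  last (ptarget p) (map (@source Q) (parrows p)).
Definition plength (p : qpath) : nat := size (parrows p).

Definition trivial_path (i : vertex Q) : qpath := @QPath (i, [::]) isT.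

(* [p] after [q], when they are composable. *)
Definition pcomp (p q : qpath) : option qpath :=
  if psource p == ptarget q then insub (ptarget p, parrows p ++ parrows q)
  else None.

Lemma qpath_inj (p q : qpath) :
  ptarget p = ptarget q -> parrows p = parrows q -> p = q.
Proof.
move=> e1 e2; apply: val_inj; rewrite /= [LHS]surjective_pairing.
by rewrite [RHS]surjective_pairing; congr (_, _).
Qed.

Lemma walk_cat i s s' :
  walk i (s ++ s') = walk i s && walk (last i (map (@source Q) s)) s'.
Proof. by elim: s i => //= x s IH i; rewrite IH andbA. Qed.

Variant pcomp_spec (p q : qpath) : option qpath -> Prop :=
| PcompSome r of psource p = ptarget q & ptarget r = ptarget p
    & parrows r = parrows p ++ parrows q & psource r = psource q :
    pcomp_spec p q (Some r)
| PcompNone of psource p <> ptarget q : pcomp_spec p q None.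

Lemma pcompP p q : pcomp_spec p q (pcomp p q).
Proof.
rewrite /pcomp; case: eqP => [e|]; last by constructor.
have w : walk (ptarget p) (parrows p ++ parrows q).
  by rewrite walk_cat (qpath_walk p) -/(psource p) e (qpath_walk q).
rewrite (@insubT _ (fun x => walk x.1 x.2) qpath (_, _) w) /=; constructor=> //.
by rewrite /psource /= map_cat last_cat -/(psource p) e.
Qed.

Lemma pcompA p q r : obind (pcomp p) (pcomp q r) = obind (pcomp^~ r) (pcomp p q).
Proof.
case: (pcompP q r) => [qr e1 t1 a1 s1|n1]; case: (pcompP p q) => [pq e2 t2 a2 s2|n2] //=.
- case: pcompP => [x ex tx ax sx|]; last by rewrite t1.
  case: pcompP => [y ey ty ay sy|]; last by rewrite s2.
  by congr Some; apply: qpath_inj; rewrite ?tx ?ty ?t2 // ax ay a1 a2 catA.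
- by case: pcompP => // x ex; rewrite t1 in ex.
- by case: pcompP => // x ex; rewrite s2 in ex.
Qed.

Lemma pcomp1p i q : pcomp (trivial_path i) q = if i == ptarget q then Some q else None.
Proof.
case: pcompP => [r e t a s|].
  by rewrite [i]e eqxx; congr Some; apply: qpath_inj; rewrite ?t.
by move/eqP/negPf => /= ->.
Qed.

Lemma pcompp1 i q : pcomp q (trivial_path i) = if i == psource q then Some q else None.
Proof.
case: pcompP => [r e t a s|].
  by rewrite e eqxx; congr Some; apply: qpath_inj; rewrite ?t // a cats0.
by move/eqP/negPf => /=; rewrite eq_sym => ->.
Qed.
End Paths.

Definition path_algebra (k : nzRingType) (Q : quiver) : Type :=
  {malg k[qpath Q]}.

HB.instance Definition _ (k : nzRingType) (Q : quiver) :=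
  GRing.Lmodule.on (path_algebra k Q).

HB.lock Definition path_mono (k : nzRingType) (Q : quiver) (c : k)
    (p : qpath Q) : path_algebra k Q := << c *g p >>.

Definition path_elt (k : nzRingType) (Q : quiver) (c : k)
    (p : option (qpath Q)) : path_algebra k Q :=
  if p is Some p then path_mono c p else 0.

HB.lock Definition path_one (k : nzRingType) (Q : quiver) : path_algebra k Q :=
  \sum_(i : vertex Q) path_mono 1 (trivial_path i).

HB.lock Definition path_mul (k : nzRingType) (Q : quiver)
    (a b : path_algebra k Q) : path_algebra k Q :=
  \sum_(p <- msupp a) \sum_(q <- msupp b) path_elt (a@_p * b@_q) (pcomp p q).

Section PathAlgebra.
Variables (k : nzRingType) (Q : quiver).

Implicit Types a b c : path_algebra k Q.

Local Notation path_one := (@path_one k Q).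
Local Notation path_mul := (@path_mul k Q).

Let F b (p : qpath Q) (x : k) : path_algebra k Q :=
  mext (fun q y => path_elt (x * y) (pcomp p q)) b.

Let path_mulE a b : path_mul a b = mext (F b) a.
Proof. by rewrite unlock. Qed.

Let path_eltB p (x y : k) : path_elt (x - y) p = path_elt x p - path_elt y p :> path_algebra k Q.
Proof.
by case: p => [p|]; [rewrite /path_elt unlock; exact: monalgUB|rewrite /path_elt subr0].
Qed.

Let G_add (x : k) (p : qpath Q) : forall q : qpath Q,
  {morph (fun y => path_elt (x * y) (pcomp p q) : path_algebra k Q) : x y / x - y}.
Proof. by move=> q y z; rewrite mulrBr path_eltB. Qed.

Let F_add b p : {morph F b p : x y / x - y}.
Proof.
move=> x y; rewrite /F /mext -sumrB; apply: eq_bigr => q _.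
by rewrite mulrBl path_eltB.
Qed.

Fact path_mulDl : left_distributive path_mul +%R.
Proof. by move=> a b c; rewrite !path_mulE; exact: mextD. Qed.

Fact path_mulDr : right_distributive path_mul +%R.
Proof.
move=> a b c; rewrite !path_mulE /mext -big_split /=; apply: eq_bigr => p _.
by rewrite /F mextD.
Qed.

Lemma path_mul0 a : path_mul a 0 = 0.
Proof. by apply: (addIr (path_mul a 0)); rewrite -path_mulDr !add0r. Qed.

Lemma path_0mul a : path_mul 0 a = 0.
Proof. by apply: (addIr (path_mul 0 a)); rewrite -path_mulDl !add0r. Qed.

Lemma path_monoE (x : k) (p : qpath Q) : path_mono x p = << x *g p >>.
Proof. by rewrite unlock. Qed.

Lemma path_algebra_ind (P : path_algebra k Q -> Prop) :
  P 0 -> (forall a b, P a -> P b -> P (a + b)) ->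
  (forall x p, P (path_mono x p)) -> forall a, P a.
Proof.
move=> P0 PD PU; apply: malg_ind => // p c.
by move: (PU c p); rewrite unlock.
Qed.

Lemma path_mulUU (x y : k) (p q : qpath Q) :
  path_mul (path_mono x p) (path_mono y q) = path_elt (x * y) (pcomp p q).
Proof.
by rewrite path_mulE [path_mono x p]path_monoE mextU // /F path_monoE mextU.
Qed.

Lemma path_additive_ext (f g : path_algebra k Q -> path_algebra k Q) :
    {morph f : x y / x + y} -> {morph g : x y / x + y} ->
    (forall x p, f (path_mono x p) = g (path_mono x p)) -> f =1 g.
Proof.
move=> fD gD fg; have f0 h : {morph h : x y / x + y} -> h (0 : path_algebra k Q) = (0 : path_algebra k Q).
  by move=> hD; apply: (addIr (h 0)); rewrite -hD !add0r.
elim/malg_ind => [|x y IH IH'|p x]; [by rewrite !f0|by rewrite fD gD IH IH'|].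
by move: (fg x p); rewrite unlock.
Qed.

Fact path_mulA : associative path_mul.
Proof.
pose f a b c := path_mul a (path_mul b c).
pose g a b c := path_mul (path_mul a b) c.
have f1 b c : {morph (fun a => f a b c) : x y / x + y} by move=> x y; exact: path_mulDl.
have f2 a c : {morph (f a)^~ c : x y / x + y}.
  by move=> x y; rewrite /f path_mulDl path_mulDr.
have f3 a b : {morph f a b : x y / x + y} by move=> x y; rewrite /f !path_mulDr.
have g1 b c : {morph (fun a => g a b c) : x y / x + y}.
  by move=> x y; rewrite /g !path_mulDl.
have g2 a c : {morph (g a)^~ c : x y / x + y}.
  by move=> x y; rewrite /g path_mulDr path_mulDl.
have g3 a b : {morph g a b : x y / x + y} by move=> x y; exact: path_mulDr.
suff fgU (x y z : k) (p q r : qpath Q) :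
    f (path_mono x p) (path_mono y q) (path_mono z r) =
    g (path_mono x p) (path_mono y q) (path_mono z r).
  move=> a b c; apply: (path_additive_ext (f1 b c) (g1 b c)) => {a} x p.
  apply: (path_additive_ext (f2 _ c) (g2 _ c)) => {b} y q.
  exact: (path_additive_ext (f3 _ _) (g3 _ _)).
rewrite /f /g (path_mulUU y z q r) (path_mulUU x y p q).
move: (pcompA p q r).
case: (pcomp q r) => [qr|]; case: (pcomp p q) => [pq|]; rewrite /obind /oapp => e.
- by rewrite (path_mulUU x _ p qr) (path_mulUU _ z pq r) e mulrA.
- by rewrite (path_mulUU x _ p qr) e path_0mul.
- by rewrite (path_mulUU _ z pq r) -e path_mul0.
- by rewrite path_0mul path_mul0.
Qed.

Lemma path_oneE :
  path_one = \sum_(i : vertex Q) path_mono 1 (trivial_path i).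
Proof. by rewrite unlock. Qed.

Fact path_mul1 : left_id path_one path_mul.
Proof.
move=> a; elim/path_algebra_ind: a => [|a a' IH IH'|x p].
- by rewrite path_mul0.
- by rewrite path_mulDr IH IH'.
have -> : path_mul path_one (path_mono x p) =
    \sum_(i : vertex Q) path_mul (path_mono 1 (trivial_path i)) (path_mono x p).
  rewrite path_oneE; elim/big_rec2: _ => [|i b c _ <-]; first exact: path_0mul.
  by rewrite path_mulDl.
rewrite (bigD1 (ptarget p)) //= big1 => [|i /negPf ni].
  by rewrite addr0 path_mulUU pcomp1p eqxx mul1r.
by rewrite path_mulUU pcomp1p ni.
Qed.

Fact path_1mul : right_id path_one path_mul.
Proof.
move=> a; elim/path_algebra_ind: a => [|a a' IH IH'|x p].
- by rewrite path_0mul.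
- by rewrite path_mulDl IH IH'.
have -> : path_mul (path_mono x p) path_one =
    \sum_(i : vertex Q) path_mul (path_mono x p) (path_mono 1 (trivial_path i)).
  rewrite path_oneE; elim/big_rec2: _ => [|i b c _ <-]; first exact: path_mul0.
  by rewrite path_mulDr.
rewrite (bigD1 (psource p)) //= big1 => [|i /negPf ni].
  by rewrite addr0 path_mulUU pcompp1 eqxx mulr1.
by rewrite path_mulUU pcompp1 ni.
Qed.

HB.instance Definition _ := GRing.Zmodule_isPzRing.Build (path_algebra k Q)
  path_mulA path_mul1 path_1mul path_mulDl path_mulDr.

Lemma path_algebra_mulUU (x y : k) (p q : qpath Q) :
  path_mono x p * path_mono y q = path_elt (x * y) (pcomp p q).
Proof. exact: path_mulUU. Qed.

Lemma path_algebra_scaleU (x y : k) (p : qpath Q) :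
  x *: path_mono y p = path_mono (x * y) p.
Proof.
rewrite (path_monoE y p) (path_monoE (x * y) p).
apply/malgP => q.
rewrite (mcoeffZ x << y *g p >> q).
apply: etrans (congr1 ( *%R x) (mcoeffU p y q)) _.
by apply: etrans _ (esym (mcoeffU p (x * y) q)); rewrite mulrnAr.
Qed.

Lemma path_algebra_scaleAl x a b : x *: (a * b) = (x *: a) * b.
Proof.
pose f a b := x *: (a * b); pose g a b := (x *: a) * b.
have f1 c : {morph (fun a => f a c) : a b / a + b}.
  by move=> y z; rewrite /f mulrDl scalerDr.
have f2 c : {morph f c : a b / a + b}.
  by move=> y z; rewrite /f mulrDr scalerDr.
have g1 c : {morph (fun a => g a c) : a b / a + b}.
  by move=> y z; rewrite /g scalerDr mulrDl.
have g2 c : {morph g c : a b / a + b} by move=> y z; rewrite /g mulrDr.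
suff fgU (y : k) (p : qpath Q) (z : k) (q : qpath Q) :
    f (path_mono y p) (path_mono z q) = g (path_mono y p) (path_mono z q).
  apply: (path_additive_ext (f1 b) (g1 b)) => {a} y p.
  exact: (path_additive_ext (f2 _) (g2 _)).
rewrite /f /g (path_algebra_mulUU y z p q) (path_algebra_scaleU x y p).
rewrite (path_algebra_mulUU (x * y) z p q); case: (pcomp p q) => [r|].
  by rewrite /path_elt (path_algebra_scaleU x (y * z) r) mulrA.
exact: scaler0.
Qed.

(* The span of the trivial paths, a subring, and the span of the arrows. *)
Definition vertex_span : {pred path_algebra k Q} :=
  fun a => all (fun p => plength p == 0%N) (msupp a).
Definition arrow_span : {pred path_algebra k Q} :=
  fun a => all (fun p => plength p == 1%N) (msupp a).

Definition homog (n : nat) (a : path_algebra k Q) : Prop :=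
  forall p, a@_p != 0 -> plength p = n.

Lemma homog_all n a :
  reflect (homog n a) (all (fun p => plength p == n) (msupp a)).
Proof.
apply: (iffP allP) => h p.
  by rewrite mcoeff_neq0 => /h /eqP.
by move=> hp; apply/eqP/h; rewrite mcoeff_neq0.
Qed.

Lemma homog0 n : homog n 0.
Proof. by move=> p; rewrite mcoeff0 eqxx. Qed.

Lemma homogB n a b : homog n a -> homog n b -> homog n (a - b).
Proof.
move=> ha hb p; rewrite mcoeffB => hp; case: (eqVneq a@_p 0) => [ea|/ha //].
by apply: hb; move: hp; rewrite ea sub0r oppr_eq0.
Qed.

Lemma homog_sum n (I : Type) (r : seq I) (f : I -> path_algebra k Q) :
  (forall i, homog n (f i)) -> homog n (\sum_(i <- r) f i).
Proof.
move=> hf; elim/big_rec: _ => [|i x _ hx]; first exact: homog0.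
rewrite -[x]opprK; apply: homogB => //; rewrite -[- x]sub0r.
by apply: homogB => //; exact: homog0.
Qed.

Lemma homogU n (x : k) (p : qpath Q) : plength p = n -> homog n (path_mono x p).
Proof.
by move=> hp q; rewrite path_monoE mcoeffU; case: (p =P q) => [<- //|_]; rewrite mulr0n eqxx.
Qed.

Lemma homogM m n a b : homog m a -> homog n b -> homog (m + n) (a * b).
Proof.
move=> /homog_all /allP ha /homog_all /allP hb.
rewrite [a * b]/GRing.mul /= unlock big_seq big_mkcond; apply: homog_sum => p.
case: ifP => [/ha /eqP hp|_]; last exact: homog0.
rewrite big_seq big_mkcond; apply: homog_sum => q.
case: ifP => [/hb /eqP hq|_]; last exact: homog0.
case: pcompP => [r _ _ er _|_] /=; last exact: homog0.
by apply: homogU; rewrite /plength er size_cat -hp -hq.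
Qed.

Lemma homog1 : homog 0 (1 : path_algebra k Q).
Proof. by rewrite /GRing.one /= path_oneE; apply: homog_sum => i; exact: homogU. Qed.

Fact vertex_span_subring : subring_closed vertex_span.
Proof.
split=> [|x y /homog_all hx /homog_all hy|x y /homog_all hx /homog_all hy];
  apply/homog_all.
- exact: homog1.
- exact: homogB.
- exact: (homogM hx hy).
Qed.

Fact arrow_span_zmod : zmod_closed arrow_span.
Proof.
split=> [|x y /homog_all hx /homog_all hy]; apply/homog_all.
- exact: homog0.
- exact: homogB.
Qed.

HB.instance Definition _ :=
  GRing.isSubringClosed.Build _ vertex_span vertex_span_subring.
HB.instance Definition _ :=
  GRing.isZmodClosed.Build _ arrow_span arrow_span_zmod.

Record vertex_ring := VertexRing {
  vertex_elt : path_algebra k Q;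
  vertex_eltP : vertex_elt \in vertex_span
}.

HB.instance Definition _ := [isSub for vertex_elt].
HB.instance Definition _ := [Choice of vertex_ring by <:].
HB.instance Definition _ := 
  GRing.SubChoice_isSubZmodule.Build _ vertex_span vertex_ring
    (GRing.subring_closedB vertex_span_subring).
HB.instance Definition _ :=
  GRing.SubZmodule_isSubPzRing.Build _ vertex_span vertex_ring
    vertex_span_subring.

Record arrow_space := ArrowSpace {
  arrow_elt : path_algebra k Q;
  arrow_eltP : arrow_elt \in arrow_span
}.

HB.instance Definition _ := [isSub for arrow_elt].
HB.instance Definition _ := [Choice of arrow_space by <:].
HB.instance Definition _ := 
  GRing.SubChoice_isSubZmodule.Build _ arrow_span arrow_space
    arrow_span_zmod.

Fact arrow_scale_subproof (r : vertex_ring) (x : arrow_space) :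
  vertex_elt r * arrow_elt x \in arrow_span.
Proof.
by apply/homog_all; apply: (@homogM 0 1); apply/homog_all;
  [exact: vertex_eltP|exact: arrow_eltP].
Qed.

Fact arrow_ract_subproof (r : vertex_ring) (x : arrow_space) :
  arrow_elt x * vertex_elt r \in arrow_span.
Proof.
by apply/homog_all; apply: (@homogM 1 0); apply/homog_all;
  [exact: arrow_eltP|exact: vertex_eltP].
Qed.

Definition arrow_scale (r : vertex_ring) (x : arrow_space) : arrow_space :=
  ArrowSpace (arrow_scale_subproof r x).

Definition arrow_ract (x : arrow_space) (r : vertex_ring) : arrow_space :=
  ArrowSpace (arrow_ract_subproof r x).

Fact arrow_scaleA (r s : vertex_ring) m :
  arrow_scale r (arrow_scale s m) = arrow_scale (r * s) m.
Proof. by apply: val_inj; rewrite /= mulrA. Qed.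

Fact arrow_scale1 : left_id 1 arrow_scale.
Proof. by move=> m; apply: val_inj; rewrite /= mul1r. Qed.

Fact arrow_scaleDr : right_distributive arrow_scale +%R.
Proof. by move=> a x y; apply: val_inj; rewrite /= mulrDr. Qed.

Fact arrow_scaleDl m : {morph arrow_scale^~ m : r s / r + s}.
Proof. by move=> r s; apply: val_inj; rewrite /= mulrDl. Qed.

HB.instance Definition _ := GRing.Zmodule_isLmodule.Build vertex_ring arrow_space
  arrow_scaleA arrow_scale1 arrow_scaleDr arrow_scaleDl.

Fact arrow_ractDl x y r :
  arrow_ract (x + y) r = arrow_ract x r + arrow_ract y r.
Proof. by apply: val_inj; rewrite /= mulrDl. Qed.

Fact arrow_ractDr x r s :
  arrow_ract x (r + s) = arrow_ract x r + arrow_ract x s.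
Proof. by apply: val_inj; rewrite /= mulrDr. Qed.

Fact arrow_ractA x r s : arrow_ract x (r * s) = arrow_ract (arrow_ract x r) s.
Proof. by apply: val_inj; rewrite /= mulrA. Qed.

Fact arrow_ract1 x : arrow_ract x 1 = x.
Proof. by apply: val_inj; rewrite /= mulr1. Qed.

Fact arrow_ractZ s x r : arrow_ract (s *: x) r = s *: arrow_ract x r.
Proof. by apply: val_inj; rewrite /= mulrA. Qed.

HB.instance Definition _ :=
  Lmodule_isBimodule.Build vertex_ring vertex_ring arrow_space
    arrow_ractDl arrow_ractDr arrow_ractA arrow_ract1 arrow_ractZ.

End PathAlgebra.

Section PathAlgebraCom.
Variables (k : comNzRingType) (Q : quiver).
Local Notation A := (path_algebra k Q).

Lemma path_algebra_scaleAr (x : k) (a b : A) : x *: (a * b) = a * (x *: b).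
Proof.
pose f (a b : A) : A := x *: (a * b); pose g (a b : A) : A := a * (x *: b).
have f1 c : {morph (fun a => f a c) : a b / a + b}.
  by move=> y z; rewrite /f mulrDl scalerDr.
have f2 c : {morph f c : a b / a + b}.
  by move=> y z; rewrite /f mulrDr scalerDr.
have g1 c : {morph (fun a => g a c) : a b / a + b} by move=> y z; rewrite /g mulrDl.
have g2 c : {morph g c : a b / a + b}.
  by move=> y z; rewrite /g scalerDr mulrDr.
suff fgU (y : k) (p : qpath Q) (z : k) (q : qpath Q) :
    f (path_mono y p) (path_mono z q) = g (path_mono y p) (path_mono z q).
  apply: (path_additive_ext (f1 b) (g1 b)) => {a} y p.
  exact: (path_additive_ext (f2 _) (g2 _)).
rewrite /f /g (path_algebra_mulUU y z p q) (path_algebra_scaleU x z q).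
rewrite (path_algebra_mulUU y (x * z) p q); case: (pcomp p q) => [r|].
  by rewrite /path_elt (path_algebra_scaleU x (y * z) r) mulrCA.
exact: scaler0.
Qed.

Lemma path_algebra_central (x : k) (a : A) : a * (x *: (1 : A)) = (x *: (1 : A)) * a.
Proof.
by rewrite -(path_algebra_scaleAr x a 1) -(path_algebra_scaleAl x 1 a) mulr1 mul1r.
Qed.

(* The left [A]-module [T], with its underlying [k]-vector space structure as
   right action: [k] acts through its central image in [A]. *)
Definition kbimod (T : lmodType A) : Type := T.

Section KBimod.
Variable T : lmodType A.

HB.instance Definition _ := GRing.Lmodule.on (kbimod T).

Definition kbimod_ract (t : kbimod T) (c : k) : kbimod T := (c *: (1 : A)) *: t.

Fact kbimod_ractDl x y r :
  kbimod_ract (x + y) r = kbimod_ract x r + kbimod_ract y r.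
Proof. by rewrite /kbimod_ract scalerDr. Qed.

Fact kbimod_ractDr x r s :
  kbimod_ract x (r + s) = kbimod_ract x r + kbimod_ract x s.
Proof. by rewrite /kbimod_ract !scalerDl. Qed.

Fact kbimod_ractA x r s : kbimod_ract x (r * s) = kbimod_ract (kbimod_ract x r) s.
Proof.
by rewrite /kbimod_ract scalerA -path_algebra_scaleAl mul1r scalerA mulrC.
Qed.

Fact kbimod_ract1 x : kbimod_ract x 1 = x.
Proof. by rewrite /kbimod_ract !scale1r. Qed.

Fact kbimod_ractZ s x r : kbimod_ract (s *: x) r = s *: kbimod_ract x r.
Proof. by rewrite /kbimod_ract !scalerA path_algebra_central. Qed.

HB.instance Definition _ := Lmodule_isBimodule.Build A k (kbimod T)
  kbimod_ractDl kbimod_ractDr kbimod_ractA kbimod_ract1 kbimod_ractZ.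

Definition finite_dim : Prop :=
  exists (n : nat) (b : 'I_n -> kbimod T),
    forall t, exists c : 'I_n -> k, t = \sum_(i < n) ract (b i) (c i).
End KBimod.

Local Notation R := (vertex_ring k Q).
Local Notation X := (arrow_space k Q).

Definition vertex_incl : {rmorphism R -> A} := val.

(* [A (x)_R L] *)
Definition tens_AR (L : lmodType A) : lmodType A :=
  tensor (bireg (idfun : {rmorphism A -> A}) vertex_incl) (restr vertex_incl L).

Definition pure_AR (L : lmodType A) (a : A) (l : L) : tens_AR L :=
  tens (a : bireg (idfun : {rmorphism A -> A}) vertex_incl) (l : restr vertex_incl L).

(* [A (x)_R X (x)_R A] *)
Definition AXA : bimodType A A :=
  tensor (tensor (bireg (idfun : {rmorphism A -> A}) vertex_incl) X)
    (bireg vertex_incl (idfun : {rmorphism A -> A})).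

(* [(A (x)_R X (x)_R A) (x)_A L] *)
Definition tens_AXA (L : lmodType A) : lmodType A := tensor AXA L.

(* [a (x) x (x) l], under the identification with [A (x)_R X (x)_R L] *)
Definition pure_AXA (L : lmodType A) (a : A) (x : X) (l : L) : tens_AXA L :=
  tens (tens (tens (a : bireg (idfun : {rmorphism A -> A}) vertex_incl) x)
    (1 : bireg vertex_incl (idfun : {rmorphism A -> A})) : AXA) l.

Section Resolution.
Variables (T : lmodType A) (M : triple (kbimod T)).

Definition TV : lmodType A := tensor (kbimod T) (tvec M).

Definition P0_map (z : TV) : (TV * tens_AR (tmod M))%type := (z, 0).

Fact P0_map_linear : linear P0_map.
Proof. by move=> a x y; congr (_, _); rewrite /= ?scaler0 ?addr0. Qed.

HB.instance Definition _ := GRing.isLinear.Build A TV (TV * tens_AR (tmod M))%type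
  _ P0_map P0_map_linear.

Definition P0 : triple (kbimod T) :=
  @Triple A k (kbimod T) (TV * tens_AR (tmod M))%type (tvec M) P0_map.

(* ['rV[k]_0] is the zero vector space. *)
Definition P1 : triple (kbimod T) :=
  @Triple A k (kbimod T) (tens_AR TV * tens_AXA (tmod M))%type 'rV[k]_0 \0.

Definition P2 : triple (kbimod T) :=
  @Triple A k (kbimod T) (tens_AXA TV) 'rV[k]_0 \0.
End Resolution.
End PathAlgebraCom.

(* Main.v *)
Require Import Defs.
From HB Require Import structures.
From mathcomp Require Import all_boot.
From mathcomp Require Import ssralg matrix.
From mathcomp Require Import boolp classical_sets monalg.

Set Implicit Arguments.
Unset Strict Implicit.
Unset Printing Implicit Defensive.

(** For a left [A]-module [L] over the path algebra [A], with vertex subring [R]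
    and arrow space [X], the sequence
      0 -> A (x)_R X (x)_R L -> A (x)_R L -> L -> 0,
    with maps [a (x) x (x) l |-> a x (x) l - a (x) x l] and [a (x) l |-> a l], is
    exact.  The reason is the existence of a derivation [D] from [A] to
    [A (x)_R X (x)_R A] that kills [R] and sends an arrow [x] to
    [1 (x) x (x) 1]: on a path it is the sum, over the arrows of the path, of
    the path cut open at that arrow ([path_diff], [path_diffM]).  The additive
    map [a (x) l |-> D a (x) l] is then a contracting homotopy
    ([contractionK], [std_diff_contraction]).  The sequence is natural in [L].

    The complex of the theorem is glued from two such sequences, those of
    [L = T (x)_k V] and of [L = M], along [f].  Its exactness is a diagram chase
    that uses exactness of both, naturality, and injectivity of the left-hand
    map for [M] ([exact_P0], [exact_P1], [boundary2_inj]).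

    Projectivity rests on vector spaces being projective
    ([vector_space_projective], by Zorn's lemma).  Since [1] is a sum of
    idempotents of [R] on each of which [R] acts by scalars, a [k]-linear lift
    can be averaged into an [R]-linear one, so that all [R]-modules are
    projective ([vertex_ring_projective]).  Extension of scalars gives the
    projectivity of [A (x)_R L] and [A (x)_R X (x)_R L].  A triple of the form
    [((T (x)_k V) + N, V, inclusion)] with [N] projective is projective, because
    its morphisms are determined freely by their restrictions to [V] and [N]
    ([triple_projective]); the three terms are of this form, with [V = 0] for
    two of them.

    Finally every module [Y] over the one-point extension comes from a triple,
    formed by the images of the two diagonal idempotents ([triple_of]), so that
    the resolutions of triples bound the global dimension. *)

Import GRing.Theory.
Local Open Scope ring_scope.

(** * Linear maps and tensor products *)

Definition linear_of (S : pzRingType) (U V : lmodType S) (f : U -> V)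
    (hf : linear f) : {linear U -> V} :=
  HB.pack_for {linear U -> V} f (GRing.isLinear.Build S U V *:%R f hf).

Section Products.
Variables (S : pzRingType) (U V W : lmodType S).

Lemma copair_linear (f : {linear U -> W}) (g : {linear V -> W}) :
  linear (fun y : U * V => f y.1 + g y.2).
Proof. by move=> a [u v] [u' v']; rewrite /= !linearP scalerDr addrACA. Qed.

Lemma pair_linear (f : {linear U -> V}) (g : {linear U -> W}) :
  linear (fun u => (f u, g u)).
Proof. by move=> a u u'; congr (_, _); rewrite /= linearP. Qed.
End Products.

Section TensorLinear.
Variables (S R : pzRingType) (U : bimodType S R) (V : lmodType R).

Lemma tensor_lift_linear (G : lmodType S) (b : U -> V -> G) :
    balanced b -> (forall s u v, b (s *: u) v = s *: b u v) ->
  linear (tensor_lift b).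
Proof.
move=> bb bZ s x y; rewrite tensor_liftD //; congr (_ + _).
move: x; apply: tensor_addf_eq => [x y'|x y'|u v].
- by rewrite scalerBr tensor_liftB.
- by rewrite tensor_liftB // scalerBr.
by rewrite tensZ !tensor_liftE.
Qed.

Definition tensor_linear (G : lmodType S) (b : U -> V -> G) (bb : balanced b)
    (bZ : forall s u v, b (s *: u) v = s *: b u v) : {linear tensor U V -> G} :=
  linear_of (tensor_lift_linear bb bZ).

Lemma tensor_linearE (G : lmodType S) (b : U -> V -> G) bb bZ u v :
  @tensor_linear G b bb bZ (u *t v) = b u v.
Proof. exact: tensor_liftE. Qed.

End TensorLinear.

Section TensorSub.
Variables (S R : pzRingType) (U : bimodType S R) (V : lmodType R).

Lemma ractB (u v : U) (p : R) :
  ract (u - v) p = ract u p - ract v p.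
Proof. by apply: (addIr (ract v p)); rewrite -ractDl !subrK. Qed.

Lemma tensBl (u u' : U) (v : V) : (u - u') *t v = u *t v - u' *t v.
Proof. by apply: (addIr (u' *t v)); rewrite -tensDl !subrK. Qed.

Lemma tensBr (u : U) (v v' : V) : u *t (v - v') = u *t v - u *t v'.
Proof. by apply: (addIr (u *t v')); rewrite -tensDr !subrK. Qed.
Lemma tensor0l (v : V) : (0 : U) *t v = 0.
Proof. by rewrite -(subrr 0) tensBl subrr. Qed.

Lemma tensor0r (u : U) : u *t (0 : V) = 0.
Proof. by rewrite -(subrr 0) tensBr subrr. Qed.
End TensorSub.

Definition restr_linear (S R : pzRingType) (phi : {rmorphism S -> R})
    (M N : lmodType R) (f : {linear M -> N}) :
  {linear restr phi M -> restr phi N}.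
Proof.
apply: (@linear_of S (restr phi M) (restr phi N) f) => s x y.
exact: (linearP f).
Defined.

(** * Projectivity over fields and over split semisimple rings *)

Section VectorSpaceLifting.
Variables (k : fieldType) (V Y Z : lmodType k).
Variables (p : {linear Y -> Z}) (f : {linear V -> Z}).
Hypothesis p_surj : forall z, exists y, p y = z.

(** The graph of a lift of [f] through [p] defined on a subspace of [V]; working
    with graphs makes the union of a chain a plain union of sets.  The last
    clause is single-valuedness.  The empty set is allowed, which is what the
    union of the empty chain is. *)
Definition partial_lift (G : set (V * Y)) : Prop :=
  [/\ forall c x y, G x -> G y -> G (c *: x + y),
      forall x, G x -> p x.2 = f x.1
    & forall x, G x -> x.1 = 0 -> x.2 = 0].

Lemma partial_lift_bigcup (F : set (set (V * Y))) :
    (F `<=` partial_lift)%classic -> total_on F subset ->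
  partial_lift (\bigcup_(G in F) G)%classic.
Proof.
move=> FP Ft; split.
- move=> c x y [G FG Gx] [H FH Hy].
  have [GH|HG] := Ft _ _ FG FH.
    by exists H => //; have [h _ _] := FP _ FH; apply: h => //; exact: GH.
  by exists G => //; have [h _ _] := FP _ FG; apply: h => //; exact: HG.
- by move=> x [G FG Gx]; have [_ h _] := FP _ FG; exact: h.
by move=> x [G FG Gx]; have [_ _ h] := FP _ FG; exact: h.
Qed.

(** A maximal graph contains the origin, and a vector outside its domain could
    be added to the domain with any preimage of its image under [f]. *)
Lemma partial_lift_total (G : set (V * Y)) : partial_lift G ->
    (forall H, (G `<` H)%classic -> ~ partial_lift H) ->
  forall v, exists y, G (v, y).
Proof.
move=> [Glin Gp G0] Gmax v; apply: contrapT => nGv.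
have G00 : G 0.
  apply: contrapT => nG; apply: (Gmax (0 |` G)%classic).
    by split=> [x Gx|G0G]; [right|apply/nG/G0G; left].
  split.
  - move=> c x y [->|Gx] [->|Gy].
    + by left; rewrite scaler0 addr0.
    + by right; rewrite scaler0 add0r.
    + by case: nG; rewrite -(addNr x) -scaleN1r; exact: Glin.
    + by right; exact: Glin.
  - by move=> x [->|/Gp //]; rewrite !linear0.
  - by move=> x [->|/G0 //].
have [y py] := p_surj (f v).
apply: (Gmax (fun w => exists c x, G x /\ w = c *: (v, y) + x)).
  split=> [x Gx|HG]; first by exists 0, x; split; rewrite // scale0r add0r.
  by apply: nGv; exists y; apply: HG; exists 1, 0; rewrite scale1r addr0.
split.
- move=> c _ _ [a [x [Gx ->]]] [b [x' [Gx' ->]]].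
  exists (c * a + b), (c *: x + x'); split; first exact: Glin.
  by rewrite scalerDr scalerA addrACA -scalerDl.
- move=> _ [a [x [Gx ->]]].
  by rewrite /= !linearD !linearZ /= py; congr (_ + _); exact: Gp.
move=> _ [a [x [Gx ->]]] /=; have [->|a0] := eqVneq a 0.
  by rewrite !scale0r !add0r; exact: G0.
(* A nonzero coefficient [a] forces [v = - a^-1 x.1], so [v] is in the domain. *)
move=> av; case: nGv; exists (- a^-1 *: x.2).
have <- : - a^-1 *: x + 0 = (v, - a^-1 *: x.2).
  rewrite addr0; congr (_, _); rewrite -(addKr (a *: v) x.1) av addr0.
  by rewrite /= scaleNr scalerN opprK scalerA mulVf // scale1r.
exact: Glin.
Qed.
End VectorSpaceLifting.

Theorem vector_space_projective (k : fieldType) (V : lmodType k) : projective V.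
Proof.
move=> Y Z p f p_surj.
have [G [PG Gmax]] := Zorn_bigcup (@partial_lift_bigcup k V Y Z p f).
have [Glin Gp G0] := PG.
have [g gG] := choice (partial_lift_total p_surj PG Gmax).
have Gfun v y : G (v, y) -> y = g v.
  move=> Gy; apply/eqP; rewrite -subr_eq0; apply/eqP.
  have := Glin (-1) _ _ (gG v) Gy; rewrite scaleN1r addrC => /G0; apply.
  by rewrite /= subrr.
have g_lin : linear g by move=> c x y; rewrite -(Gfun _ _ (Glin c _ _ (gG x) (gG y))).
by exists (linear_of g_lin) => v; exact: (Gp _ (gG v)).
Qed.

(** A lift [g0] linear over the scalars becomes [R]-linear after
    averaging to [l |-> \sum_i e_i g0 (e_i l)]: multiplying by [r] on either
    side of [e_i] amounts to multiplying by one and the same scalar, and [g0]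
    commutes with that scalar. *)
Lemma split_ring_projective (k : fieldType) (R : pzRingType)
    (kappa : {rmorphism k -> R}) (I : finType) (e : I -> R) :
    \sum_i e i = 1 -> (forall i, e i * e i = e i) ->
    (forall i r, exists c, e i * r = kappa c * e i /\ r * e i = e i * kappa c) ->
  forall L : lmodType R, projective L.
Proof.
move=> e1 eK eC L Y Z p f p_surj.
have [g0 pg0] := vector_space_projective (p := restr_linear kappa p)
  (restr_linear kappa f) p_surj.
have g0Z c l : g0 (kappa c *: (l : L)) = kappa c *: (g0 l : Y) by exact: (linearZ_LR g0 c l).
have g_lin : linear (fun l : L => \sum_i e i *: (g0 (e i *: l) : Y)).
  move=> r x y; rewrite scaler_sumr -big_split; apply: eq_bigr => i _ /=.
  have [c [er re]] := eC i r.
  rewrite scalerDr scalerA er -scalerA.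
  rewrite (linearD g0 (kappa c *: (e i *: x)) (e i *: y)) g0Z scalerDr.
  by rewrite [_ *: (_ *: _)]scalerA -re -scalerA.
exists (linear_of g_lin) => l /=; rewrite linear_sum -[f l]scale1r -e1 scaler_suml.
apply: eq_bigr => i _; rewrite linearZ; have := pg0 (e i *: l); rewrite /= => ->.
by rewrite linearZ /= scalerA eK.
Qed.

(** * Generators of the path algebra and its vertex subring *)

Section Generation.
Variables (k : comNzRingType) (Q : quiver).
Local Notation A := (path_algebra k Q).
Local Notation R := (vertex_ring k Q).
Local Notation X := (arrow_space k Q).

(** The restriction to monomials of one length makes this usable on the vertex
    span and the arrow span, where induction on all monomials would leave the
    subspace. *)
Lemma homog_ind n (P : A -> Prop) : P 0 ->
    (forall a b, P a -> P b -> P (a + b)) ->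
    (forall c p, plength p = n -> P (path_mono c p)) ->
  forall a, homog n a -> P a.
Proof.
move=> P0 PD PU a /homog_all/allP a_n; rewrite (monalgE a) big_seq.
elim/big_ind: _ => // p /a_n/eqP pn.
by rewrite -path_monoE; exact: PU.
Qed.

Fact vertex_mono_subproof (c : k) (i : vertex Q) :
  path_mono c (trivial_path i) \in @vertex_span k Q.
Proof. by apply/homog_all/homogU. Qed.

Definition vertex_mono c i : R := VertexRing (vertex_mono_subproof c i).

Definition arrow_path (x : arrow Q) : qpath Q :=
  @QPath Q (target x, [:: x]) (introT andP (conj (eqxx _) isT)).

Fact arrow_mono_subproof (c : k) (x : arrow Q) :
  path_mono c (arrow_path x) \in @arrow_span k Q.
Proof. by apply/homog_all/homogU. Qed.

Definition arrow_mono c x : X := ArrowSpace (arrow_mono_subproof c x).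

Lemma vertex_ring_ind (P : R -> Prop) : P 0 ->
    (forall r s, P r -> P s -> P (r + s)) -> (forall c i, P (vertex_mono c i)) ->
  forall r, P r.
Proof.
move=> P0 PD PU r.
suff [s /val_inj -> //] : exists2 s : R, vertex_elt r = vertex_elt s & P s.
move: (vertex_elt r) (homog_all _ _ (vertex_eltP r)).
apply: homog_ind => [|_ _ [s -> Ps] [s' -> Ps']|c p p0]; first by exists 0.
  by exists (s + s') => //; exact: PD.
exists (vertex_mono c (ptarget p)) => //=; congr path_mono.
by apply: qpath_inj => //; apply: size0nil.
Qed.

Lemma arrow_space_ind (P : X -> Prop) : P 0 ->
    (forall x y, P x -> P y -> P (x + y)) -> (forall c x, P (arrow_mono c x)) ->
  forall x, P x.
Proof.
move=> P0 PD PU x.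
suff [s /val_inj -> //] : exists2 s : X, arrow_elt x = arrow_elt s & P s.
move: (arrow_elt x) (homog_all _ _ (arrow_eltP x)).
apply: homog_ind => [|_ _ [s -> Ps] [s' -> Ps']|c p p1]; first by exists 0.
  by exists (s + s') => //; exact: PD.
case: p p1 => -[i [|y []]] pw //= _.
exists (arrow_mono c y) => //=; congr path_mono.
by have /= /andP[/eqP yi _] := pw; exact: qpath_inj.
Qed.

(** Splits off the last arrow traversed, the one at the head of the list. *)
Lemma path_mono_cons c (p : qpath Q) x s : parrows p = x :: s ->
  exists q : qpath Q, [/\ parrows q = s, ptarget q = source x, ptarget p = target x
    & path_mono c p = path_mono 1 (arrow_path x) * path_mono c q :> A].
Proof.
case: p => -[i t] /= w; rewrite /parrows /= => tE; subst t.
have /= /andP[/eqP xi ws] := w; subst i.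
exists (@QPath Q (source x, s) ws); split=> //.
rewrite path_algebra_mulUU mul1r; case: pcompP => [r _ tr ar _|] //=.
by congr path_mono; apply: qpath_inj.
Qed.

(** The path algebra is generated as a ring by the vertex subring and the arrow
    space; identities that are compatible with products need only be checked
    there. *)
Lemma path_algebra_generated (P : A -> Prop) :
    (forall a b, P a -> P b -> P (a + b)) ->
    (forall a b, P a -> P b -> P (a * b)) ->
    (forall r : R, P (vertex_elt r)) -> (forall x : X, P (arrow_elt x)) ->
  forall a, P a.
Proof.
move=> PD PM PR PX; elim/path_algebra_ind => [||c p].
- exact: (PR 0).
- exact: PD.
elim: {p}(parrows p) {-2}p (erefl (parrows p)) => [|x s IH] p pE.
  have -> : p = trivial_path (ptarget p) by exact: qpath_inj.
  exact: (PR (vertex_mono c _)).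
have [q [qE _ _ ->]] := path_mono_cons c pE.
by apply: PM; [exact: (PX (arrow_mono 1 x))|exact: IH].
Qed.

Lemma vertex_monoM c d i j :
  vertex_mono c i * vertex_mono d j = if i == j then vertex_mono (c * d) i else 0.
Proof.
apply: val_inj; rewrite /= path_algebra_mulUU pcomp1p.
by rewrite -[ptarget _]/j; case: (i =P j) => [->|].
Qed.

Lemma sum_vertex_mono : \sum_i vertex_mono 1 i = 1.
Proof. by apply: val_inj; rewrite raddf_sum /= [RHS]path_oneE. Qed.

Fact vertex_const_subproof (c : k) : c *: (1 : A) \in @vertex_span k Q.
Proof.
rewrite [1 : A]path_oneE scaler_sumr; apply/homog_all/homog_sum => i.
by rewrite path_algebra_scaleU; exact: homogU.
Qed.

Definition vertex_const c : R := VertexRing (vertex_const_subproof c).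

Fact vertex_const_zmod : zmod_morphism vertex_const.
Proof. by move=> c d; apply: val_inj; rewrite /= scalerBl. Qed.

Fact vertex_const_monoid : monoid_morphism vertex_const.
Proof.
split=> [|c d]; apply: val_inj; first exact: scale1r.
by rewrite /= -path_algebra_scaleAl mul1r scalerA.
Qed.

HB.instance Definition _ :=
  GRing.isZmodMorphism.Build k R vertex_const vertex_const_zmod.
HB.instance Definition _ :=
  GRing.isMonoidMorphism.Build k R vertex_const vertex_const_monoid.

Lemma vertex_const_mull c r : val (vertex_const c * r) = c *: val r.
Proof. by rewrite /= -path_algebra_scaleAl mul1r. Qed.

Lemma vertex_const_mulr c r : val (r * vertex_const c) = c *: val r.
Proof. by rewrite /= -path_algebra_scaleAr mulr1. Qed.

(** The vertex subring is a product of copies of the field, one per vertex; the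
    scalar is the component of [r] at [i]. *)
Lemma vertex_mono_scalar i (r : R) : exists c : k,
  vertex_mono 1 i * r = vertex_const c * vertex_mono 1 i /\
  r * vertex_mono 1 i = vertex_mono 1 i * vertex_const c.
Proof.
elim/vertex_ring_ind: r => [|r s [c [cl cr]] [d [dl dr]]|c j].
- by exists 0; rewrite raddf0 !mulr0 !mul0r.
- by exists (c + d); rewrite raddfD !mulrDl !mulrDr cl cr dl dr.
exists (if i == j then c else 0); rewrite !vertex_monoM [j == i]eq_sym mul1r mulr1.
case: eqP => [<-|_]; last by rewrite raddf0 mulr0 mul0r.
split; apply: val_inj; rewrite ?vertex_const_mull ?vertex_const_mulr /=;
  by rewrite path_algebra_scaleU mulr1.
Qed.
End Generation.

Theorem vertex_ring_projective (k : fieldType) (Q : quiver)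
  (L : lmodType (vertex_ring k Q)) : projective L.
Proof.
apply: (@split_ring_projective k _ (@vertex_const k Q) _
  (@vertex_mono k Q 1)); first exact: sum_vertex_mono.
  by move=> i; rewrite vertex_monoM eqxx mul1r.
exact: vertex_mono_scalar.
Qed.

(** * Maps out of iterated tensor products *)

Section PureTensors.
Variables (k : comNzRingType) (Q : quiver).
Local Notation A := (path_algebra k Q).
Local Notation R := (vertex_ring k Q).
Local Notation X := (arrow_space k Q).
Local Notation AR := (bireg (idfun : {rmorphism A -> A}) (@vertex_incl k Q)).
Local Notation RA := (bireg (@vertex_incl k Q) (idfun : {rmorphism A -> A})).

Section Pure.
Variable L : lmodType A.

Lemma pure_ARDl a b (l : L) : pure_AR (a + b) l = pure_AR a l + pure_AR b l.
Proof. exact: tensDl. Qed.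
Lemma pure_ARDr a (l m : L) : pure_AR a (l + m) = pure_AR a l + pure_AR a m.
Proof. exact: tensDr. Qed.
Lemma pure_ARM a (r : R) (l : L) :
  pure_AR (a * vertex_elt r) l = pure_AR a (vertex_elt r *: l).
Proof. exact: (tensM (a : AR) r (l : restr (@vertex_incl k Q) L)). Qed.
Lemma pure_ARZ s a (l : L) : s *: pure_AR a l = pure_AR (s * a) l.
Proof. exact: tensZ. Qed.

Lemma pure_AXADl a b x (l : L) :
  pure_AXA (a + b) x l = pure_AXA a x l + pure_AXA b x l.
Proof. by rewrite /pure_AXA -!tensDl. Qed.
Lemma pure_AXADm a x y (l : L) :
  pure_AXA a (x + y) l = pure_AXA a x l + pure_AXA a y l.
Proof. by rewrite /pure_AXA -!tensDl -tensDr. Qed.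
Lemma pure_AXADr a x (l m : L) :
  pure_AXA a x (l + m) = pure_AXA a x l + pure_AXA a x m.
Proof. exact: tensDr. Qed.
Lemma pure_AXAZ s a x (l : L) : s *: pure_AXA a x l = pure_AXA (s * a) x l.
Proof. by rewrite /pure_AXA !tensZ. Qed.
Lemma pure_AXAMl a (r : R) x (l : L) :
  pure_AXA (a * vertex_elt r) x l = pure_AXA a (r *: x) l.
Proof. by rewrite /pure_AXA -tensM. Qed.
Lemma tens_AXAE (a : AR) (x : X) (c : RA) (l : L) :
  (a *t x *t c : AXA k Q) *t l = pure_AXA a x (c *: l).
Proof. by rewrite /pure_AXA -tensM tens_ract /ract /= /bireg_ract mul1r. Qed.
Lemma pure_AXAMr a x (r : R) (l : L) :
  pure_AXA a (ract x r) l = pure_AXA a x (vertex_elt r *: l).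
Proof.
rewrite -tens_AXAE /pure_AXA -tens_ract tensM; congr (_ *t _ *t _).
by rewrite /GRing.scale /= /bireg_scale mulr1.
Qed.

(** The middle factor [A] of the iterated tensor product can always be absorbed
    into the module, so the pure tensors with [1] there suffice. *)
Lemma tens_AXA_ind (P : tens_AXA L -> Prop) :
    (forall x y, P x -> P y -> P (x - y)) ->
    (forall a x l, P (pure_AXA a x l)) ->
  forall z, P z.
Proof.
move=> PB PU; apply: tensor_ind => // w l; move: w.
apply: tensor_ind => [w w' Pw Pw'|y c]; first by rewrite tensBl; exact: PB.
move: y; apply: tensor_ind => [y y' Py Py'|a x]; first by rewrite !tensBl; exact: PB.
by rewrite tens_AXAE.
Qed.

Section Lift.
Variables (G : lmodType A) (b : A -> X -> L -> G).

(** The conditions on a map of three variables to factor through the iterated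
    tensor product over the vertex subring.  Linearity over the path algebra
    in the first variable is included since only linear maps are built. *)
Definition AXA_balanced : Prop :=
  [/\ forall x l, linear (fun a : A^o => b a x l),
      forall a x y l, b a (x + y) l = b a x l + b a y l,
      forall a x l m, b a x (l + m) = b a x l + b a x m,
      forall a (r : R) x l, b (a * vertex_elt r) x l = b a (r *: x) l
    & forall a x (r : R) l, b a (ract x r) l = b a x (vertex_elt r *: l)].

Hypothesis b_bal : AXA_balanced.

Let bZ s a x l : b (s * a) x l = s *: b a x l.
Proof.
have [bl _ _ _ _] := b_bal.
have b0 : b 0 x l = 0.
  by have := bl x l (-1) 0 0; rewrite scaleN1r addNr => ->; rewrite scaleN1r addNr.
have := bl x l s a 0; rewrite b0 !addr0; exact.
Qed.

Let bD a a' x l : b (a + a') x l = b a x l + b a' x l.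
Proof. by have [/(_ x l 1 a a') + _ _ _ _] := b_bal; rewrite !scale1r. Qed.

Let b1 l : balanced (fun (a : AR) (x : X) => b a x l).
Proof.
have [bl bm br bM1 bM2] := b_bal.
by split=> [a a' x|a x x'|a r x]; [exact: bD|exact: bm|exact: bM1].
Qed.
Let f1 l : {linear tensor AR X -> G} :=
  tensor_linear (b1 l) (fun s a x => bZ s a x l).
Let f1E l a x : f1 l (a *t x) = b a x l.
Proof. exact: tensor_linearE. Qed.

Let f1D l m w : f1 (l + m) w = f1 l w + f1 m w.
Proof.
have [_ _ br _ _] := b_bal.
move: w; apply: tensor_addf_eq => [x y|x y|a x]; rewrite ?linearB //.
  by rewrite opprD addrACA.
by rewrite !f1E br.
Qed.

Let f1M w r l : f1 l (ract w r) = f1 (vertex_elt r *: l) w.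
Proof.
have [_ _ _ _ bM] := b_bal.
move: w; apply: tensor_addf_eq => [x y|x y|a x]; rewrite ?linearB //.
  by rewrite ractB linearB.
by rewrite tens_ract !f1E bM.
Qed.

Let b2 l : balanced (fun (w : tensor AR X) (c : RA) => f1 (c *: l) w).
Proof.
split => [w w' c|w c c'|w r c]; first exact: linearD.
  by rewrite scalerDl f1D.
by rewrite f1M scalerA.
Qed.
Let f2 l : {linear AXA k Q -> G} :=
  tensor_linear (b2 l) (fun s w c => linearZ_LR (f1 (c *: l)) s w).
Let f2E l a x c : f2 l (a *t x *t c) = b a x (c *: l).
Proof. by rewrite [LHS]tensor_linearE f1E. Qed.

Lemma AXA_ext (H : zmodType) (f g : AXA k Q -> H) :
    {morph f : x y / x - y} -> {morph g : x y / x - y} ->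
    (forall (a : AR) (x : X) (c : RA), f (a *t x *t c) = g (a *t x *t c)) ->
  f =1 g.
Proof.
move=> fB gB fg; apply: tensor_addf_eq => // w c; move: w.
apply: tensor_ind => [x y fx fy|a x //]; by rewrite tensBl fB gB fx fy.
Qed.

Let f2D l m w : f2 (l + m) w = f2 l w + f2 m w.
Proof.
have [_ _ br _ _] := b_bal.
move: w; apply: AXA_ext => [x y|x y|a x c]; rewrite ?linearB //.
  by rewrite opprD addrACA.
by rewrite !f2E scalerDr br.
Qed.

Let f2M l w a : f2 l (ract w a) = f2 (a *: l) w.
Proof.
move: w; apply: AXA_ext => [x y|x y|a' x c]; rewrite ?linearB //.
  by rewrite ractB linearB.
by rewrite tens_ract !f2E scalerA.
Qed.

Let b3 : balanced (fun (w : AXA k Q) (l : L) => f2 l w).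
Proof.
by split => [w w' l|w l l'|w r l]; [exact: linearD|exact: f2D|exact: f2M].
Qed.

Definition AXA_lift : {linear tens_AXA L -> G} :=
  tensor_linear b3 (fun s w l => linearZ_LR (f2 l) s w).

Lemma AXA_liftE a x l : AXA_lift (pure_AXA a x l) = b a x l.
Proof. by rewrite [LHS]tensor_linearE f2E scale1r. Qed.
End Lift.
End Pure.
End PureTensors.

(** * The path-cutting derivation *)

Section Derivation.
Variables (k : comNzRingType) (Q : quiver).
Local Notation A := (path_algebra k Q).
Local Notation R := (vertex_ring k Q).
Local Notation X := (arrow_space k Q).
Local Notation AR := (bireg (idfun : {rmorphism A -> A}) (@vertex_incl k Q)).
Local Notation RA := (bireg (@vertex_incl k Q) (idfun : {rmorphism A -> A})).

Lemma vertex_mono_mul c d i (q : qpath Q) :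
  vertex_elt (vertex_mono c i) * path_mono d q =
  if i == ptarget q then path_mono (c * d) q else 0 :> A.
Proof. by rewrite /= path_algebra_mulUU pcomp1p; case: ifP. Qed.

Lemma arrow_mono_scale c d (x : arrow Q) :
  vertex_mono c (target x) *: arrow_mono d x = arrow_mono (c * d) x :> X.
Proof.
apply: val_inj; rewrite /= path_algebra_mulUU pcomp1p.
by rewrite -[ptarget _]/(target x) eqxx.
Qed.

Lemma arrow_mono_ract c d (x : arrow Q) i :
  ract (arrow_mono c x) (vertex_mono d i) =
  if i == source x then arrow_mono (c * d) x else 0 :> X.
Proof.
apply: val_inj; rewrite /= path_algebra_mulUU pcompp1.
by rewrite -[psource _]/(source x); case: eqP.
Qed.

(** The monomial of a list of arrows, without the idempotent of its target; it
    is a total function of the list, whatever its composability, which allows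
    plain recursion on lists. *)
Definition word (s : seq (arrow Q)) : A := \prod_(x <- s) arrow_elt (arrow_mono 1 x).

Lemma path_mono_word c (p : qpath Q) :
  path_mono c p = vertex_elt (vertex_mono c (ptarget p)) * word (parrows p) :> A.
Proof.
elim: {p}(parrows p) {-2}p (erefl (parrows p)) => [|x s IH] p pE.
  rewrite pE /word big_nil mulr1; congr path_mono.
  exact: qpath_inj.
have [q [qE tq tp ->]] := path_mono_cons c pE.
rewrite (IH q qE) pE qE tq tp /word big_cons !mulrA; congr (_ * _).
rewrite -[RHS]/(arrow_elt (vertex_mono c _ *: arrow_mono 1 x)).
rewrite -[LHS]/(arrow_elt (ract (arrow_mono 1 x) _)).
by rewrite arrow_mono_scale arrow_mono_ract eqxx mul1r mulr1.
Qed.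

Definition axa (a : A) (x : X) (c : A) : AXA k Q := (a : AR) *t x *t (c : RA).

Lemma axaDm a x y c : axa a (x + y) c = axa a x c + axa a y c.
Proof. by rewrite /axa tensDr tensDl. Qed.
Lemma axaDr a x c d : axa a x (c + d) = axa a x c + axa a x d.
Proof. exact: tensDr. Qed.
Lemma axa_scale s a x c : s *: axa a x c = axa (s * a) x c.
Proof. by rewrite /axa !tensZ. Qed.
Lemma axa_ract a x c d : ract (axa a x c) d = axa a x (c * d).
Proof. exact: tens_ract. Qed.
Lemma axaMl a (r : R) x c : axa (a * vertex_elt r) x c = axa a (r *: x) c.
Proof. by rewrite /axa -tensM. Qed.
Lemma axaMr a x (r : R) c : axa a (ract x r) c = axa a x (vertex_elt r * c).
Proof. by rewrite /axa -tens_ract tensM. Qed.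
Lemma axa0 a c : axa a 0 c = 0.
Proof. by apply: (addIr (axa a 0 c)); rewrite -axaDm !add0r. Qed.

(** The Leibniz rule on a product of arrows, solved recursively: the sum over
    the positions of the list of the word cut open at that arrow. *)
Fixpoint word_diff (s : seq (arrow Q)) : AXA k Q :=
  if s is x :: s' then
    axa 1 (arrow_mono 1 x) (word s') + arrow_elt (arrow_mono 1 x) *: word_diff s'
  else 0.

(** The idempotent of the target is put back on the left, where it makes the
    contribution of a list correct for the path. *)
Definition path_diff (a : A) : AXA k Q :=
  mext (fun (p : qpath Q) c =>
    vertex_elt (vertex_mono c (ptarget p)) *: word_diff (parrows p)) a.

Let diff_add (p : qpath Q) :
  {morph (fun c => vertex_elt (vertex_mono c (ptarget p)) *: word_diff (parrows p))
    : c d / c - d}.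
Proof. by move=> c d; rewrite -scalerBl /= !path_monoE monalgUB. Qed.

Lemma path_diffB : {morph path_diff : a b / a - b}.
Proof. exact: (mextB diff_add). Qed.

Lemma path_diffD : {morph path_diff : a b / a + b}.
Proof. exact: (mextD diff_add). Qed.

Lemma path_diff0 : path_diff 0 = 0.
Proof. by rewrite -[X in path_diff X](subrr 0) path_diffB subrr. Qed.

Lemma path_diff_mono c (p : qpath Q) : path_diff (path_mono c p) =
  vertex_elt (vertex_mono c (ptarget p)) *: word_diff (parrows p).
Proof. by rewrite path_monoE /path_diff (mextU diff_add). Qed.

Lemma path_diff_vertex (r : R) : path_diff (vertex_elt r) = 0.
Proof.
elim/vertex_ring_ind: r => [|r s hr hs|c i]; first exact: path_diff0.
  by rewrite [vertex_elt _]/(vertex_elt r + vertex_elt s) path_diffD hr hs addr0.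
by rewrite path_diff_mono scaler0.
Qed.

Lemma path_diff_arrow (x : X) : path_diff (arrow_elt x) = axa 1 x 1.
Proof.
elim/arrow_space_ind: x => [|x y hx hy|c x]; first by rewrite path_diff0 axa0.
  by rewrite [arrow_elt _]/(arrow_elt x + arrow_elt y) path_diffD hx hy axaDm.
rewrite path_diff_mono -[parrows _]/[:: x] [word_diff _]/= /word big_nil scaler0 addr0.
rewrite axa_scale mulr1 -[vertex_elt _]mul1r axaMl [ptarget _]/(target x).
by rewrite arrow_mono_scale mulr1.
Qed.

(** This and [path_diff_arrowM] are the Leibniz rule for a left factor among the
    generators, the only case that needs the composition of paths. *)
Lemma path_diff_vertexM (r : R) a : path_diff (vertex_elt r * a) = vertex_elt r *: path_diff a.
Proof.
elim/vertex_ring_ind: r => [|r s hr hs|c i].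
- by rewrite mul0r path_diff0 scale0r.
- by rewrite [vertex_elt _]/(vertex_elt r + vertex_elt s) mulrDl path_diffD hr hs scalerDl.
elim/path_algebra_ind: a => [|a b ha hb|d q].
- by rewrite mulr0 path_diff0 scaler0.
- by rewrite mulrDr [LHS]path_diffD ha hb path_diffD scalerDr.
rewrite path_diff_mono scalerA !vertex_mono_mul -[ptarget (trivial_path _)]/(ptarget q).
case: eqP => [_|_]; last by rewrite path_diff0 scale0r.
by rewrite path_diff_mono.
Qed.

Lemma path_diff_arrowM (x : X) a :
  path_diff (arrow_elt x * a) = axa 1 x a + arrow_elt x *: path_diff a.
Proof.
elim/arrow_space_ind: x => [|x y hx hy|c x].
- by rewrite mul0r path_diff0 scale0r axa0 addr0.
- rewrite [arrow_elt _]/(arrow_elt x + arrow_elt y) mulrDl path_diffD hx hy.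
  by rewrite scalerDl axaDm addrACA.
elim/path_algebra_ind: a => [|a b ha hb|d q].
- rewrite mulr0 path_diff0 scaler0 addr0.
  by apply: (addIr (axa 1 (arrow_mono c x) 0)); rewrite -axaDr !add0r.
- by rewrite mulrDr [LHS]path_diffD ha hb path_diffD scalerDr axaDr addrACA.
rewrite path_diff_mono scalerA.
rewrite -[_ * vertex_elt _]/(arrow_elt (ract (arrow_mono c x) _)).
rewrite {2}path_mono_word -axaMr arrow_mono_ract path_algebra_mulUU.
case: pcompP => [r sx tr ar _|]; last first.
  rewrite [psource _]/(source x) => /eqP; rewrite eq_sym => /negPf ->.
  by rewrite path_diff0 axa0 scale0r addr0.
rewrite -[ptarget q]sx [psource _]/(source x) eqxx /= path_diff_mono.
rewrite tr ar -[parrows _ ++ _]/(x :: parrows q) -[ptarget _]/(target x) [word_diff _]/= scalerDr.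
rewrite axa_scale mulr1 scalerA.
rewrite vertex_mono_mul -[ptarget (arrow_path _)]/(target x) eqxx mulr1; congr (_ + _).
by rewrite -[vertex_elt _]mul1r axaMl arrow_mono_scale mulr1.
Qed.

(** The left factors for which the rule holds with every right factor are stable
    under products, so the two generating cases are enough. *)
Theorem path_diffM a b :
  path_diff (a * b) = ract (path_diff a) b + a *: path_diff b.
Proof.
elim/path_algebra_generated: a b => [a a' ha ha'|a a' ha ha'|r|x] b.
- by rewrite mulrDl !path_diffD ha ha' ractDl scalerDl addrACA.
- by rewrite -mulrA !ha ha' ractDl ractA ractZ scalerDr scalerA addrA.
- by rewrite path_diff_vertexM path_diff_vertex ract0l add0r.
by rewrite path_diff_arrowM path_diff_arrow axa_ract mul1r.
Qed.
End Derivation.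

(** * The standard resolution over the path algebra *)

(** Extension of scalars is left adjoint to restriction, which preserves
    surjections: lift [l |-> f (1 (x) l)] and extend by linearity. *)
Lemma extension_projective (S R : pzRingType) (phi : {rmorphism R -> S})
    (L : lmodType R) : projective L ->
  projective (tensor (bireg (idfun : {rmorphism S -> S}) phi) L).
Proof.
set U := bireg _ _ => projL Y Z p f p_surj.
have f1_lin : linear ((fun l => f ((1 : U) *t l)) : L -> restr phi Z).
  move=> r x y; rewrite tensDr -tensM linearD; congr (_ + _).
  rewrite /ract /= /bireg_ract mul1r -[LHS]/(f ((phi r : U) *t x)).
  rewrite -[RHS]/(phi r *: (f ((1 : U) *t x) : Z)) -linearZ /= tensZ.
  by rewrite /GRing.scale /= /bireg_scale mulr1.
have [g pg] := projL _ _ (restr_linear phi p) (linear_of f1_lin) p_surj.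
pose b (s : U) (l : L) : Y := (s : S) *: (g l : Y).
have b_bal : balanced b.
  rewrite /b; split=> [s s' l|s l l'|s r l]; first exact: scalerDl.
    by rewrite linearD; exact: scalerDr.
  by rewrite linearZ_LR; symmetry; exact: (scalerA s (phi r) (g l : Y)).
have bZ s u l : b (s *: u) l = s *: b u l by rewrite /b -scalerA.
exists (tensor_linear b_bal bZ).
have fE (s : U) l : f (s *t l) = (s : S) *: f ((1 : U) *t l).
  by rewrite -linearZ tensZ /GRing.scale /= /bireg_scale mulr1.
apply: tensor_addf_eq => [x y|x y|s l]; rewrite ?linearB //.
by rewrite tensor_linearE fE linearZ; congr (_ *: _); exact: (pg l).
Qed.

Section Resolution.
Variables (k : comNzRingType) (Q : quiver).
Local Notation A := (path_algebra k Q).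
Local Notation R := (vertex_ring k Q).
Local Notation X := (arrow_space k Q).
Local Notation AR := (bireg (idfun : {rmorphism A -> A}) (@vertex_incl k Q)).
Local Notation RA := (bireg (@vertex_incl k Q) (idfun : {rmorphism A -> A})).

Lemma tens_AR_ext (L : lmodType A) (H : zmodType) (f g : tens_AR L -> H) :
    {morph f : x y / x - y} -> {morph g : x y / x - y} ->
    (forall a l, f (pure_AR a l) = g (pure_AR a l)) -> f =1 g.
Proof. exact: tensor_addf_eq. Qed.

Lemma tens_AXA_ext (L : lmodType A) (H : zmodType) (f g : tens_AXA L -> H) :
    {morph f : x y / x - y} -> {morph g : x y / x - y} ->
    (forall a x l, f (pure_AXA a x l) = g (pure_AXA a x l)) -> f =1 g.
Proof.
by move=> fB gB fg; apply: tens_AXA_ind => // x y fx fy; rewrite fB gB fx fy.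
Qed.

Section Functor.
Variables (L : lmodType A).

Fact action_bal : balanced (fun (a : AR) (l : restr (@vertex_incl k Q) L) => (a : A) *: (l : L)).
Proof.
split=> [a b l|a l m|a r l]; [exact: scalerDl|exact: scalerDr|].
by symmetry; exact: (scalerA (a : A) (vertex_elt r) (l : L)).
Qed.
Definition action : {linear tens_AR L -> L} :=
  tensor_linear action_bal (fun s a l => esym (scalerA s (a : A) (l : L))).
Lemma actionE a l : action (pure_AR a l) = a *: l.
Proof. exact: tensor_linearE. Qed.

Variables (N : lmodType A) (f : {linear L -> N}).

Fact AR_map_bal : balanced (fun (a : AR) (l : restr (@vertex_incl k Q) L) => pure_AR a (f l)).
Proof.
split=> [a b l|a l m|a r l]; first exact: pure_ARDl.
  by rewrite -pure_ARDr -linearD.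
rewrite [LHS]pure_ARM; congr (pure_AR _ _).
by rewrite -linearZ.
Qed.
Definition AR_map : {linear tens_AR L -> tens_AR N} :=
  tensor_linear AR_map_bal (fun s a l => esym (pure_ARZ s a (f l))).
Lemma AR_mapE a l : AR_map (pure_AR a l) = pure_AR a (f l).
Proof. exact: tensor_linearE. Qed.

Fact AXA_map_bal : AXA_balanced (fun a x l => pure_AXA a x (f l)).
Proof.
split=> [x l s a b|a x y l|a x l m|a r x l|a x r l].
- by rewrite pure_AXADl -pure_AXAZ.
- exact: pure_AXADm.
- by rewrite linearD pure_AXADr.
- exact: pure_AXAMl.
- by rewrite pure_AXAMr linearZ.
Qed.
Definition AXA_map : {linear tens_AXA L -> tens_AXA N} := AXA_lift AXA_map_bal.
Lemma AXA_mapE a x l : AXA_map (pure_AXA a x l) = pure_AXA a x (f l).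
Proof. exact: AXA_liftE. Qed.
End Functor.

Section Exactness.
Variables (L : lmodType A).

Lemma pure_ARBr a (l m : L) : pure_AR a (l - m) = pure_AR a l - pure_AR a m.
Proof. exact: tensBr. Qed.

Fact std_diff_bal : AXA_balanced
  (fun a x (l : L) => pure_AR (a * arrow_elt x) l - pure_AR a (arrow_elt x *: l)).
Proof.
split=> [x l s a b|a x y l|a x l m|a r x l|a x r l].
- rewrite mulrDl !pure_ARDl scalerBr !pure_ARZ opprD addrACA.
  by rewrite mulrA.
- by rewrite /= mulrDr scalerDl pure_ARDl pure_ARDr opprD addrACA.
- by rewrite scalerDr !pure_ARDr opprD addrACA.
- by rewrite pure_ARM /= mulrA scalerA.
- by rewrite /= mulrA pure_ARM scalerA.
Qed.
Definition std_diff : {linear tens_AXA L -> tens_AR L} := AXA_lift std_diff_bal.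
Lemma std_diffE a x (l : L) : std_diff (pure_AXA a x l) =
  pure_AR (a * arrow_elt x) l - pure_AR a (arrow_elt x *: l).
Proof. exact: AXA_liftE. Qed.

Fact contraction_bal : balanced
  (fun (a : AR) (l : restr (@vertex_incl k Q) L) => path_diff (a : A) *t (l : L) : tens_AXA L).
Proof.
split=> [a b l|a l m|a r l]; first by rewrite path_diffD tensDl.
  exact: tensDr.
rewrite [path_diff _]path_diffM path_diff_vertex scaler0 addr0.
exact: tensM.
Qed.
(** Only additive: the homotopy is not linear over the path algebra. *)
Definition contraction : tens_AR L -> tens_AXA L :=
  tensor_lift (fun (a : AR) (l : restr (@vertex_incl k Q) L) =>
    path_diff (a : A) *t (l : L) : tens_AXA L).
Lemma contractionB : {morph contraction : x y / x - y}.
Proof. exact: (tensor_liftB contraction_bal). Qed.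
Lemma contractionE a l : contraction (pure_AR a l) = path_diff a *t l.
Proof. exact: (tensor_liftE contraction_bal). Qed.

(** By the Leibniz rule, [D (a x) (x) l - D a (x) x l] is [a D x (x) l], and
    [D x = 1 (x) x (x) 1]. *)
Lemma contractionK : cancel std_diff contraction.
Proof.
apply: (@tens_AXA_ext L _ (fun x => contraction (std_diff x)) id) => [x y|x y|a x l] //.
  by rewrite linearB contractionB.
rewrite std_diffE contractionB !contractionE path_diffM tensDl tensM addrC addKr.
by rewrite path_diff_arrow axa_scale mulr1.
Qed.

(** Both sides satisfy the same product rule in [a], so the comparison reduces to
    the generators. *)
Lemma std_diff_path_diff a (l : L) :
  std_diff (path_diff a *t l) = pure_AR a l - pure_AR 1 (a *: l).
Proof.
elim/path_algebra_generated: a l => [a b ha hb|a b ha hb|r|x] l.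
- by rewrite path_diffD tensDl linearD ha hb pure_ARDl scalerDl pure_ARDr opprD addrACA.
- rewrite path_diffM tensDl linearD tensM ha -tensZ linearZ_LR hb.
  by rewrite scalerBr !pure_ARZ mulr1 scalerA addrC addrA subrK.
- rewrite path_diff_vertex -[vertex_elt r]mul1r pure_ARM mul1r subrr.
  by rewrite tensor0l linear0.
by rewrite path_diff_arrow -[axa 1 x 1 *t l]/(pure_AXA 1 x l) std_diffE mul1r.
Qed.

Lemma std_diff_contraction y :
  std_diff (contraction y) = y - pure_AR 1 (action L y).
Proof.
move: y; apply: tens_AR_ext => [x y|x y|a l].
- by rewrite contractionB linearB.
- by rewrite linearB pure_ARBr opprD addrACA opprD.
by rewrite contractionE actionE std_diff_path_diff.
Qed.

Lemma action_std_diff z : action L (std_diff z) = 0.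
Proof.
move: z; apply: (@tens_AXA_ext L _ (fun z => action L (std_diff z)) (fun=> 0)) => [x y|x y|a x l].
- by rewrite !linearB.
- by rewrite subr0.
by rewrite std_diffE linearB !actionE scalerA subrr.
Qed.

Lemma action_exact y : action L y = 0 -> y = std_diff (contraction y).
Proof.
move=> y0; rewrite std_diff_contraction y0.
by rewrite -[X in pure_AR 1 X](subrr (0 : L)) pure_ARBr subrr subr0.
Qed.

Lemma std_diff_inj : injective std_diff.
Proof. exact: can_inj contractionK. Qed.
End Exactness.

Lemma action_natural (L N : lmodType A) (f : {linear L -> N}) y :
  action N (AR_map f y) = f (action L y).
Proof.
move: y; apply: tens_AR_ext => [x y|x y|a l]; try by rewrite !linearB.
by rewrite AR_mapE !actionE linearZ.
Qed.

Lemma std_diff_natural (L N : lmodType A) (f : {linear L -> N}) z :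
  std_diff N (AXA_map f z) = AR_map f (std_diff L z).
Proof.
move: z; apply: tens_AXA_ext => [x y|x y|a x l]; try by rewrite !linearB.
by rewrite AXA_mapE !std_diffE linearB !AR_mapE linearZ.
Qed.
End Resolution.


Section Projectives.
Variables (k : fieldType) (Q : quiver).
Local Notation A := (path_algebra k Q).
Local Notation X := (arrow_space k Q).

Lemma tens_AR_projective (L : lmodType A) : projective (tens_AR L).
Proof. exact/extension_projective/vertex_ring_projective. Qed.

(** This is the extension of scalars of the [R]-module [X (x)_R L], written as a
    different iterated tensor product; the lift is taken on that module and
    extended by [AXA_lift]. *)
Lemma tens_AXA_projective (L : lmodType A) : projective (tens_AXA L).
Proof.
pose i := @vertex_incl k Q; pose XL := tensor X (restr i L).
move=> Y Z p f p_surj.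
have f1_bal : balanced ((fun x l => f (pure_AXA 1 x (l : L))) : X -> restr i L -> restr i Z).
  split=> [x y l|x l m|x r l].
  - by rewrite pure_AXADm linearD.
  - by rewrite [pure_AXA _ _ _]pure_AXADr linearD.
  by rewrite pure_AXAMr.
have f1Z (r : vertex_ring k Q) x (l : restr i L) :
    f (pure_AXA 1 (r *: x) (l : L)) = r *: (f (pure_AXA 1 x (l : L)) : restr i Z).
  rewrite -pure_AXAMl mul1r -[RHS]/(vertex_elt r *: (f (pure_AXA 1 x l) : Z)).
  by rewrite -linearZ /= pure_AXAZ mulr1.
have [g pg] := @vertex_ring_projective k Q XL _ _ (restr_linear i p)
  (tensor_linear f1_bal f1Z) p_surj.
have b_bal : AXA_balanced (fun a x (l : L) => a *: (g (x *t (l : restr i L)) : Y)).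
  split=> [x l s a b|a x y l|a x l m|a r x l|a x r l].
  - by rewrite scalerDl -scalerA.
  - by rewrite tensDl linearD; exact: scalerDr.
  - by rewrite tensDr linearD; exact: scalerDr.
  - by rewrite -tensZ linearZ_LR -scalerA.
  by rewrite tensM.
exists (AXA_lift b_bal).
apply: tens_AXA_ext => [x y|x y|a x l]; try by rewrite !linearB.
rewrite AXA_liftE linearZ -[a in RHS]mulr1 -pure_AXAZ linearZ /=; congr (_ *: _).
by rewrite [LHS](pg _) tensor_linearE.
Qed.
End Projectives.

(** * Modules over the one-point extension and triples *)

(** A multiplicative embedding that need not preserve [1]: the image [e] of [1]
    is an idempotent, and [e Y] is a [B]-module for every [S]-module [Y].  It is
    used for the two diagonal entries of the one-point extension. *)
Record corner_embedding (B S : pzRingType) := CornerEmbedding {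
  corner_map :> B -> S;
  corner_mapB : {morph corner_map : x y / x - y};
  corner_mapM : {morph corner_map : x y / x * y}
}.

Section Corner.
Variables (B S : pzRingType) (j : corner_embedding B S).

Lemma corner_mapD : {morph j : x y / x + y}.
Proof.
move=> x y; have j0 : j 0 = 0 by rewrite -[X in j X](subrr 0) corner_mapB subrr.
have jN z : j (- z) = - j z by rewrite -sub0r corner_mapB j0 sub0r.
by rewrite -[y in LHS]opprK corner_mapB jN opprK.
Qed.

Section CornerModule.
Variable Y : lmodType S.

Definition corner_pred : {pred Y} := fun y => j 1 *: y == y.

Fact corner_pred_zmod : zmod_closed corner_pred.
Proof.
split=> [|x y]; first by rewrite unfold_in scaler0.
by rewrite !unfold_in scalerBr => /eqP -> /eqP ->.
Qed.

Record corner := Corner { corner_val : Y; corner_valP : corner_val \in corner_pred }.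

HB.instance Definition _ := [isSub for corner_val].
HB.instance Definition _ := [Choice of corner by <:].
HB.instance Definition _ :=
  GRing.SubChoice_isSubZmodule.Build _ corner_pred corner corner_pred_zmod.

Lemma corner_val1 (y : corner) : j 1 *: corner_val y = corner_val y.
Proof. exact/eqP/corner_valP. Qed.

Lemma corner_mem b (y : Y) : j b *: y \in corner_pred.
Proof. by rewrite unfold_in scalerA -corner_mapM mul1r. Qed.

Definition corner_scale b (y : corner) : corner := Corner (corner_mem b (corner_val y)).

Fact corner_scaleA a b y : corner_scale a (corner_scale b y) = corner_scale (a * b) y.
Proof. by apply: val_inj; rewrite /= scalerA corner_mapM. Qed.
Fact corner_scale1 : left_id 1 corner_scale.
Proof. by move=> y; apply: val_inj; exact: corner_val1. Qed.
Fact corner_scaleDr : right_distributive corner_scale +%R.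
Proof. by move=> a x y; apply: val_inj; rewrite /= scalerDr. Qed.
Fact corner_scaleDl y : {morph corner_scale^~ y : a b / a + b}.
Proof. by move=> a b; apply: val_inj; rewrite /= corner_mapD scalerDl. Qed.

HB.instance Definition _ := GRing.Zmodule_isLmodule.Build B corner
  corner_scaleA corner_scale1 corner_scaleDr corner_scaleDl.

Lemma corner_valD (x y : corner) : corner_val (x + y) = corner_val x + corner_val y.
Proof. by []. Qed.
Lemma corner_valZ b (y : corner) : corner_val (b *: y) = j b *: corner_val y.
Proof. by []. Qed.
End CornerModule.

Variables (Y Z : lmodType S) (p : {linear Y -> Z}).

Fact corner_linear_mem (y : corner Y) : p (corner_val y) \in @corner_pred Z.
Proof. by rewrite unfold_in -linearZ /= corner_val1. Qed.
Fact corner_linear_lin : linear (fun y => Corner (corner_linear_mem y)).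
Proof. by move=> a x y; apply: val_inj; rewrite /= linearP. Qed.
Definition corner_linear : {linear corner Y -> corner Z} := linear_of corner_linear_lin.

Lemma corner_linear_surj :
  (forall z, exists y, p y = z) -> forall z, exists y, corner_linear y = z.
Proof.
move=> p_surj z; have [y py] := p_surj (corner_val z).
by exists (Corner (corner_mem 1 y)); apply: val_inj; rewrite /= linearZ /= py corner_val1.
Qed.
End Corner.

Section Triples.
Variables (A K : pzRingType) (T : bimodType A K).
Local Notation B := (one_point T).

Fact upper_cornerB : {morph (fun a => (a, 0, 0) : B) : x y / x - y}.
Proof. by move=> x y; congr (_, _, _); rewrite subr0. Qed.
Fact upper_cornerM : {morph (fun a => (a, 0, 0) : B) : x y / x * y}.
Proof. by move=> x y; congr (_, _, _); rewrite /= ?scaler0 ?ract0 ?addr0 ?mulr0. Qed.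
Definition upper := CornerEmbedding upper_cornerB upper_cornerM.

Fact lower_cornerB : {morph (fun l => (0, 0, l) : B) : x y / x - y}.
Proof. by move=> x y; congr (_, _, _); rewrite subr0. Qed.
Fact lower_cornerM : {morph (fun l => (0, 0, l) : B) : x y / x * y}.
Proof. by move=> x y; congr (_, _, _); rewrite /= ?scaler0 ?ract0l ?addr0 ?mulr0. Qed.
Definition lower := CornerEmbedding lower_cornerB lower_cornerM.

(** Multiplication by these elements carries the lower corner of a module into
    the upper one; this is the structure map of the associated triple. *)
Definition off_diag (t : T) : B := (0, t, 0).

Lemma off_diagD : {morph off_diag : t u / t + u}.
Proof. by move=> t u; congr (_, _, _); rewrite addr0. Qed.
Lemma off_diag_scale a t : off_diag (a *: t) = upper a * off_diag t.
Proof. by congr (_, _, _); rewrite /= ?mulr0 ?ract0l ?addr0. Qed.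
Lemma off_diag_ract t l : off_diag (ract t l) = off_diag t * lower l.
Proof. by congr (_, _, _); rewrite /= ?mulr0 ?mul0r ?scale0r ?add0r. Qed.

Lemma triple_linear_lin (X X' : triple T) (phi : {linear tmod X -> tmod X'})
    (psi : {linear tvec X -> tvec X'}) :
    (forall t v, phi (tmap X (t *t v)) = tmap X' (t *t psi v)) ->
  linear ((fun y => (phi y.1, psi y.2)) : triple_module X -> triple_module X').
Proof.
move=> comm s [m v] [m' v']; congr (_, _); rewrite /= ?linearP //.
by rewrite !linearD linearZ_LR comm.
Qed.

Section Evaluation.
Variables (V : lmodType K) (Y : lmodType B) (psi : {linear V -> corner lower Y}).

Fact off_diag_mem t (y : Y) : off_diag t *: y \in @corner_pred _ _ upper Y.
Proof.
by rewrite unfold_in scalerA -off_diag_scale scale1r.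
Qed.

Fact off_diag_bal :
  balanced (fun t v => Corner (off_diag_mem t (corner_val (psi v)))).
Proof.
split=> [t u v|t v w|t r v]; apply: val_inj; rewrite /=.
- by rewrite off_diagD scalerDl.
- by rewrite linearD corner_valD scalerDr.
by rewrite linearZ_LR corner_valZ scalerA off_diag_ract.
Qed.

Fact off_diagZ a t v :
  Corner (off_diag_mem (a *: t) (corner_val (psi v))) =
  a *: Corner (off_diag_mem t (corner_val (psi v))).
Proof. by apply: val_inj; rewrite /= off_diag_scale scalerA. Qed.

Definition evaluation : {linear tensor T V -> corner upper Y} :=
  tensor_linear off_diag_bal off_diagZ.

Lemma evaluationE t v : corner_val (evaluation (t *t v)) = off_diag t *: corner_val (psi v).
Proof. by rewrite tensor_linearE. Qed.
End Evaluation.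

Definition triple_of (Y : lmodType B) : triple T :=
  @Triple A K T (corner upper Y) (corner lower Y) (evaluation idfun).

Section Assemble.
Variables (X : triple T) (Y : lmodType B).
Variables (phi : {linear tmod X -> corner upper Y}) (psi : {linear tvec X -> corner lower Y}).
Hypothesis comm : forall t v,
  corner_val (phi (tmap X (t *t v))) = off_diag t *: corner_val (psi v).

Fact assemble_lin : linear
  ((fun y => corner_val (phi y.1) + corner_val (psi y.2)) : triple_module X -> Y).
Proof.
move=> s [m v] [m' v'] /=.
rewrite !linearD !linearZ_LR !corner_valD !corner_valZ comm addrACA; congr (_ + _).
rewrite -addrA -scalerDl scalerDr; congr (_ + _).
  rewrite -[in RHS]corner_val1 scalerA; congr (_ *: _).
  by congr (_, _, _); rewrite /= ?mulr1 ?mulr0 ?scaler0 ?ract0 ?addr0.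
rewrite -[in RHS]corner_val1 scalerA; congr (_ *: _).
by congr (_, _, _); rewrite /= ?mulr1 ?mulr0 ?scaler0 ?ract1 ?addr0 ?add0r.
Qed.

(** A morphism from a triple into the triple of [Y], read in [Y], which is the
    direct sum of its two corners. *)
Definition assemble : {linear triple_module X -> Y} := linear_of assemble_lin.

Lemma assembleE m v : assemble (m, v) = corner_val (phi m) + corner_val (psi v).
Proof. by []. Qed.
End Assemble.

Section TripleOf.
Variable Y : lmodType B.

Definition from_triple_of : {linear triple_module (triple_of Y) -> Y} :=
  @assemble (triple_of Y) Y idfun idfun (@evaluationE _ _ idfun).

Lemma lower_upper0 (y : corner upper Y) : lower 1 *: corner_val y = 0.
Proof.
rewrite -corner_val1 scalerA (_ : _ * _ = 0) ?scale0r //.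
by congr (_, _, _); rewrite /= ?mul0r ?mulr0 ?scaler0 ?ract0 ?addr0.
Qed.

Lemma upper_lower0 (y : corner lower Y) : upper 1 *: corner_val y = 0.
Proof.
rewrite -corner_val1 scalerA (_ : _ * _ = 0) ?scale0r //.
by congr (_, _, _); rewrite /= ?mul0r ?mulr0 ?scaler0 ?ract0l ?addr0.
Qed.

Lemma from_triple_of_inj y : from_triple_of y = 0 -> y = 0.
Proof.
case: y => m v; rewrite [LHS]assembleE => mv0.
congr (_, _); apply: val_inj; rewrite /=.
  by have := congr1 ( *:%R (upper 1)) mv0; rewrite scalerDr corner_val1 upper_lower0 addr0 scaler0.
by have := congr1 ( *:%R (lower 1)) mv0; rewrite scalerDr corner_val1 lower_upper0 add0r scaler0.
Qed.

Lemma from_triple_of_surj y : exists x, from_triple_of x = y.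
Proof.
exists (Corner (@corner_mem _ _ upper _ 1 y), Corner (@corner_mem _ _ lower _ 1 y)).
rewrite [LHS]assembleE /= -scalerDl -[RHS]scale1r; congr (_ *: _).
by congr (_, _, _); rewrite /= ?addr0 ?add0r.
Qed.
End TripleOf.

(** The hypotheses say that [X] is [(T (x) V, V, id)] plus [(N, 0, 0)], the
    decomposition of the module component being given by [tmap X], [q], [i] and
    [s].  A morphism out of [X] is the same thing as a linear map from [V] to the
    lower corner and one from [N] to the upper corner of the target, and these
    can be lifted separately. *)
Lemma triple_projective (X : triple T) (N : lmodType A) (i : {linear N -> tmod X})
    (s : {linear tmod X -> N}) (q : {linear tmod X -> tensor T (tvec X)}) :
    projective N -> projective (tvec X) ->
    (forall t v, q (tmap X (t *t v)) = t *t v) ->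
    (forall t v, s (tmap X (t *t v)) = 0) ->
    (forall m, m = tmap X (q m) + i (s m)) ->
  projective (triple_module X).
Proof.
move=> projN projV qK s0 decomp Y Z p f p_surj.
have fN_mem n : f (i n, 0) \in @corner_pred _ _ upper Z.
  rewrite unfold_in -linearZ; apply/eqP; congr (f _); congr (_, _).
    by rewrite /= scale1r tens0l linear0 addr0.
  by rewrite /= scaler0.
have fN_lin : linear (fun n => Corner (fN_mem n)).
  move=> a x y; apply: val_inj; rewrite /= -linearZ -linearD /=; congr (f _); congr (_, _).
    by rewrite /= linearP tens0l linear0 addr0.
  by rewrite /= scaler0 addr0.
have fV_mem v : f (0, v) \in @corner_pred _ _ lower Z.
  rewrite unfold_in -linearZ; apply/eqP; congr (f _); congr (_, _).
    by rewrite /= scaler0 tens0l linear0 addr0.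
  by rewrite /= scale1r.
have fV_lin : linear (fun v => Corner (fV_mem v)).
  move=> a x y; apply: val_inj; rewrite /= -linearZ -linearD /=; congr (f _); congr (_, _).
  by rewrite /= scaler0 tens0l linear0 !addr0.
have [gN pgN] := projN _ _ _ (linear_of fN_lin) (corner_linear_surj (j := upper) p_surj).
have [gV pgV] := projV _ _ _ (linear_of fV_lin) (corner_linear_surj (j := lower) p_surj).
have {}pgN n : p (corner_val (gN n)) = f (i n, 0) := congr1 (@corner_val _ _ _ _) (pgN n).
have {}pgV v : p (corner_val (gV v)) = f (0, v) := congr1 (@corner_val _ _ _ _) (pgV v).
pose phi0 m := evaluation gV (q m) + gN (s m).
have phi_lin : linear phi0.
  by move=> a x y; rewrite /phi0 !linearP scalerDr addrACA.
have comm t v : corner_val (linear_of phi_lin (tmap X (t *t v))) = off_diag t *: corner_val (gV v).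
  by rewrite /= /phi0 qK s0 linear0 addr0 evaluationE.
exists (assemble comm) => -[m v].
rewrite assembleE linearD pgV /= linearD pgN.
(* On [T (x) V] the lift is imposed by its values on [V]. *)
have -> z : p (corner_val (evaluation gV z)) = f (tmap X z, 0).
  move: z; apply: tensor_addf_eq => [x y|x y|t w].
  - by rewrite !linearB.
  - rewrite -linearB; congr (f _); congr (_, _); rewrite /= ?subr0 ?linearB //.
  rewrite evaluationE linearZ /= pgV -linearZ; congr (f _); congr (_, _).
    by rewrite /= scaler0 add0r.
  by rewrite /= scale0r.
rewrite -!linearD [in RHS](decomp m); congr (f _); congr (_, _).
  by rewrite /= addr0.
by rewrite /= !add0r.
Qed.

End Triples.

Lemma prod_projective (S : pzRingType) (U V : lmodType S) :
  projective U -> projective V -> projective (U * V)%type.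
Proof.
move=> projU projV Y Z p f p_surj.
have fU_lin : linear (fun u => f (u, 0)).
  by move=> a x y; rewrite -linearP; congr (f _); congr (_, _); rewrite /= scaler0 addr0.
have fV_lin : linear (fun v => f (0, v)).
  by move=> a x y; rewrite -linearP; congr (f _); congr (_, _); rewrite /= scaler0 addr0.
have [gU pgU] := projU _ _ p (linear_of fU_lin) p_surj.
have [gV pgV] := projV _ _ p (linear_of fV_lin) p_surj.
exists (linear_of (copair_linear gU gV)) => -[u v]; rewrite /= linearD pgU pgV /= -linearD.
by congr (f _); congr (_, _); rewrite /= ?addr0 ?add0r.
Qed.

Lemma subsingleton_projective (S : pzRingType) (U : lmodType S) :
  (forall x : U, x = 0) -> projective U.
Proof. by move=> U0 Y Z p f _; exists \0 => x; rewrite (U0 x) !linear0. Qed.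

Lemma proj_dim_le2 (S : pzRingType) (M P0 P1 P2 : lmodType S)
    (e : {linear P0 -> M}) (g : {linear P1 -> P0}) (h : {linear P2 -> P1}) :
    projective P0 -> projective P1 -> projective P2 ->
    injective h -> exact_at h g -> exact_at g e ->
    (forall y, exists x, e x = y) ->
  proj_dim_le 2 M.
Proof.
move=> proj0 proj1 proj2 h_inj hg ge e_surj.
pose P i : lmodType S := match i with
  | 0 => P0 | 1 => P1 | 2 => P2 | _ => 'rV[S]_0 end%N.
pose d i : {linear P i.+1 -> P i} := match i with
  | 0 => g | 1 => h | i'.+2 => \0 end%N.
have rV0 (x : 'rV[S]_0) : x = 0 by exact: thinmx0.
exists P, d, e; split; last by case=> [|[|[|i]]].
split=> //.
  by move=> [|[|[|i]]] //; exact: subsingleton_projective.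
move=> [|[|i]] //= x; last by split=> [_|[y <-]//]; exists 0; rewrite (rV0 x).
split=> [/= hx0|[y <-]]; last by rewrite linear0.
by exists 0; apply: h_inj; rewrite !linear0.
Qed.

(** * The resolution over the one-point extension *)

Section OnePointResolution.
Variables (k : closedFieldType) (Q : quiver) (T : lmodType (path_algebra k Q)).
Local Notation A := (path_algebra k Q).
Variable M : triple (kbimod T).

Definition aug_tmod : {linear (TV M * tens_AR (tmod M))%type -> tmod M} :=
  linear_of (copair_linear (tmap M) (action _)).

Fact aug_comm t v :
  aug_tmod (tmap (P0 M) (t *t v)) = tmap M (t *t (idfun v : tvec M)).
Proof. by rewrite -[LHS]/(tmap M (t *t v) + action (tmod M) 0) linear0 addr0. Qed.

Definition aug : {linear triple_module (P0 M) -> triple_module M} :=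
  linear_of (@triple_linear_lin _ _ _ (P0 M) M aug_tmod idfun aug_comm).

Lemma augE z y v : aug ((z, y), v) = (tmap M z + action _ y, v).
Proof. by []. Qed.

Definition boundary1_tmod :
    {linear (tens_AR (TV M) * tens_AXA (tmod M))%type -> (TV M * tens_AR (tmod M))%type} :=
  linear_of (pair_linear (action (TV M) \o fst)
    (linear_of (copair_linear (\- AR_map (tmap M)) (std_diff _)))).

Fact boundary1_comm t v : boundary1_tmod (tmap (P1 M) (t *t v)) =
  tmap (P0 M) (t *t (\0 : {linear 'rV[k]_0 -> tvec M}) v).
Proof. by rewrite -[tmap (P1 M) _]/0 linear0 /= tensor0r. Qed.

Definition boundary1 : {linear triple_module (P1 M) -> triple_module (P0 M)} :=
  linear_of (@triple_linear_lin _ _ _ (P1 M) (P0 M) boundary1_tmod \0 boundary1_comm).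

Lemma boundary1E u w v : boundary1 ((u, w), v) =
  ((action _ u, - AR_map (tmap M) u + std_diff _ w), 0).
Proof. by []. Qed.

Definition boundary2_tmod :
    {linear tens_AXA (TV M) -> (tens_AR (TV M) * tens_AXA (tmod M))%type} :=
  linear_of (pair_linear (std_diff _) (AXA_map (tmap M))).

Fact boundary2_comm t v : boundary2_tmod (tmap (P2 M) (t *t v)) =
  tmap (P1 M) (t *t (\0 : {linear 'rV[k]_0 -> 'rV[k]_0}) v).
Proof. by rewrite -[tmap (P2 M) _]/0 linear0. Qed.

Definition boundary2 : {linear triple_module (P2 M) -> triple_module (P1 M)} :=
  linear_of (@triple_linear_lin _ _ _ (P2 M) (P1 M) boundary2_tmod \0 boundary2_comm).

Lemma boundary2E w v : boundary2 (w, v) = ((std_diff _ w, AXA_map (tmap M) w), 0).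
Proof. by []. Qed.

Lemma aug_surj (y : triple_module M) : exists x, aug x = y.
Proof.
case: y => m v; exists ((0, pure_AR 1 m), v).
by rewrite augE actionE linear0 add0r scale1r.
Qed.

(** Modulo the boundary of [1 (x) z] one may assume [z = 0]; this costs the term
    [1 (x) f z] in the other component, which is then a cycle of the standard
    resolution of [M]. *)
Lemma exact_P0 : exact_at boundary1 aug.
Proof.
move=> [[z y] v]; split=> [|[[[u w] v'] <-]]; last first.
  rewrite boundary1E augE linearD linearN action_natural action_std_diff.
  by rewrite addr0 addrN.
rewrite augE => -[zy0 ->].
have zyE : action _ (y + pure_AR 1 (tmap M z)) = 0.
  by rewrite linearD actionE scale1r addrC.
exists ((pure_AR 1 z, contraction (y + pure_AR 1 (tmap M z))), 0).
rewrite boundary1E actionE scale1r AR_mapE -action_exact //.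
by rewrite addrCA addNr addr0.
Qed.

(** The first component of a cycle is a boundary in the standard resolution of
    [T (x) V]; the second is then determined, since the differential of [M] is
    injective and natural. *)
Lemma exact_P1 : exact_at boundary2 boundary1.
Proof.
move=> [[u w] v]; split=> [|[[w' v'] <-]]; last first.
  by rewrite boundary2E boundary1E action_std_diff std_diff_natural addNr.
rewrite boundary1E => -[/action_exact uE uw0].
exists (contraction u, 0); rewrite boundary2E -uE (thinmx0 v).
congr ((_, _), _); apply: std_diff_inj; rewrite std_diff_natural -uE.
by apply/eqP; rewrite eq_sym -subr_eq0 addrC uw0.
Qed.

Lemma boundary2_inj : injective boundary2.
Proof.
move=> [w v] [w' v']; rewrite !boundary2E => -[/std_diff_inj -> _].
by rewrite (thinmx0 v) (thinmx0 v').
Qed.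

Lemma P0_projective : projective (triple_module (P0 M)).
Proof.
pose N := tens_AR (tmod M).
apply: (@triple_projective _ _ _ (P0 M) N
  (linear_of (pair_linear (\0 : {linear N -> TV M}) idfun)) snd fst) => //.
- exact: tens_AR_projective.
- exact: vector_space_projective.
by move=> [z n]; congr (_, _); rewrite /= ?addr0 ?add0r.
Qed.

(** The case [V = 0] of [triple_projective], with zero [q]. *)
Lemma tmod_projective (N : lmodType A) (f : {linear tensor (kbimod T) 'rV[k]_0 -> N}) :
  projective N -> projective (triple_module (@Triple A k (kbimod T) N 'rV[k]_0 f)).
Proof.
move=> projN.
have tv0 (t : kbimod T) (v : 'rV[k]_0) : t *t v = 0.
  by rewrite (thinmx0 v) tensor0r.
apply: (@triple_projective _ _ _ (Triple f) N idfun idfun \0) => //=.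
- exact: vector_space_projective.
- by move=> t v; rewrite tv0 linear0.
- by move=> m; rewrite linear0 add0r.
Qed.

Lemma P1_projective : projective (triple_module (P1 M)).
Proof.
apply/tmod_projective/prod_projective; first exact: tens_AR_projective.
exact: tens_AXA_projective.
Qed.

Lemma P2_projective : projective (triple_module (P2 M)).
Proof. exact/tmod_projective/tens_AXA_projective. Qed.
End OnePointResolution.

Lemma proj_dim_le_iso (S : pzRingType) n (M N : lmodType S) (f : {linear M -> N}) :
  (forall x, f x = 0 -> x = 0) -> (forall y, exists x, f x = y) ->
  proj_dim_le n M -> proj_dim_le n N.
Proof.
move=> f_inj f_surj [P [d [e [[projP e_surj ex0 ex] P0]]]].
have fe_lin : linear (fun x => f (e x)) by move=> a x y; rewrite !linearP.
exists P, d, (linear_of fe_lin); split=> //; split=> // [y|x].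
  have [x <-] := f_surj y; have [z <-] := e_surj x; by exists z.
rewrite -ex0; split=> /= [/f_inj //|->]; exact: linear0.
Qed.

Theorem theorem3p3 (k : closedFieldType) (Q : quiver)
    (T : lmodType (path_algebra k Q)) (T_findim : finite_dim T) :
  (forall M : triple (kbimod T),
    exists (e : {linear triple_module (P0 M) -> triple_module M})
           (g : {linear triple_module (P1 M) -> triple_module (P0 M)})
           (h : {linear triple_module (P2 M) -> triple_module (P1 M)}),
    [/\ forall (z : TV M) (a : path_algebra k Q) (m : tmod M) (v : tvec M),
          e ((z, pure_AR a m), v) = (tmap M z + a *: m, v),
        forall (a : path_algebra k Q) (t : kbimod T) (v : tvec M)
               (a' : path_algebra k Q) (x : arrow_space k Q) (m : tmod M),
          g ((pure_AR a (t *t v : TV M), pure_AXA a' x m), 0) =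
          (((a *: t) *t v,
            - pure_AR a (tmap M (t *t v)) + pure_AR (a' * arrow_elt x) m
              - pure_AR a' (arrow_elt x *: m)),
           0)
      & forall (a : path_algebra k Q) (x : arrow_space k Q) (t : kbimod T)
               (v : tvec M),
          h (pure_AXA a x (t *t v : TV M), 0) =
          ((pure_AR (a * arrow_elt x) (t *t v : TV M)
              - pure_AR a ((arrow_elt x *: t) *t v : TV M),
            pure_AXA a x (tmap M (t *t v))),
           0)]
    /\
    [/\ projective (triple_module (P0 M)),
        projective (triple_module (P1 M))
      & projective (triple_module (P2 M))]
    /\
    [/\ injective h, exact_at h g, exact_at g e
      & forall y : triple_module M, exists x, e x = y])
  /\ gldim_le (one_point (kbimod T)) 2.
Proof.
split=> [M|Y].
  exists (aug M), (boundary1 M), (boundary2 M); split; last split.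
  - split=> [z a m v|a t v a' x m|a x t v].
    + by rewrite augE actionE.
    + by rewrite boundary1E actionE AR_mapE std_diffE addrA tensZ.
    + by rewrite boundary2E std_diffE AXA_mapE tensZ.
  - by split; [exact: P0_projective|exact: P1_projective|exact: P2_projective].
  - split; [exact: boundary2_inj|exact: exact_P1|exact: exact_P0|exact: aug_surj].
apply: proj_dim_le_iso (@from_triple_of_inj _ _ _ Y) (@from_triple_of_surj _ _ _ Y) _.
pose M := triple_of Y.
exact: (proj_dim_le2 (@P0_projective _ _ _ M) (@P1_projective _ _ _ M)
  (@P2_projective _ _ _ M) (@boundary2_inj _ _ _ M) (@exact_P1 _ _ _ M)
  (@exact_P0 _ _ _ M) (@aug_surj _ _ _ M)).
Qed.
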